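(* Let $P$ be a closed bounded convex polyhedron in $\mathbb{R}^d$ with distinct vertices $a_1,\dots,a_n$, where $n\ge 2$, and let $d_1\ge 1$ be an integer. Let $u:\mathbb{R}^{d_1}\to P$ be a $P$-valued function such that the first and second order derivatives of $u$ are bounded and continuous on $\mathbb{R}^{d_1}$. Then there exist real-valued nonnegative functions $u_1(y),\dots,u_n(y)$ on $\mathbb{R}^{d_1}$ such that for all $y\in\mathbb{R}^{d_1}$ $$\sum_{k=1}^n u_k(y)=1,\qquad u(y)=\sum_{k=1}^n u_k(y)a_k,$$ and the functions $u_k^{1/2}$, $k=1,\dots,n$, are Lipschitz continuous on $\mathbb{R}^{d_1}$ with a constant which depends only on $P$ and $\sup\{|u_{(\eta)(\eta)}(y)|:\ |\eta|=1,\ y\in\mathbb{R}^{d_1}\}$.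
   Context: For a (vector- or real-valued) function $w(z)$ on a Euclidean space and a vector $\eta$ in that space, $w_{(\eta)}=\sum_i\eta^i w_{z^i}$ and $w_{(\eta)(\eta)}=\sum_{i,j}\eta^i\eta^j w_{z^iz^j}$ denote the first and second directional derivatives. $|\cdot|$ is the Euclidean norm. *)

(* Defs.v *)
From HB Require Import structures.
From mathcomp Require Import all_boot all_order all_algebra.
From mathcomp Require Import all_classical all_reals all_analysis.

Set Implicit Arguments.
Unset Strict Implicit.
Unset Printing Implicit Defensive.

Import Order.TTheory GRing.Theory Num.Theory.
Import numFieldNormedType.Exports.

Local Open Scope classical_set_scope.
Local Open Scope ring_scope.

Definition dotv (R : realType) (m : nat) (x y : 'rV[R]_m) : R :=
  \sum_(i < m) x 0 i * y 0 i.

(* The library norm `|x| on 'rV[R]_m is the sup norm; it is used below only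
   for topology, differentiability and boundedness, where the choice of norm
   is immaterial. *)
Definition enorm (R : realType) (m : nat) (x : 'rV[R]_m) : R :=
  Num.sqrt (dotv x x).

(* Finite intersections of closed half-spaces. They are closed and convex;
   they may have empty interior, and boundedness is a separate hypothesis. *)
Definition polyhedron (R : realType) (d : nat) (P : set 'rV[R]_d) : Prop :=
  exists (m : nat) (c : 'I_m -> 'rV[R]_d) (b : 'I_m -> R),
    P = [set x | forall i, dotv (c i) x <= b i].

(* Extreme points: members of P lying in the interior of no nondegenerate
   segment contained in P. *)
Definition vertices (R : realType) (d : nat) (P : set 'rV[R]_d) :
    set 'rV[R]_d :=
  [set x | P x /\ forall (y z : 'rV[R]_d) (t : R),
     P y -> P z -> 0 < t < 1 -> x = t *: y + (1 - t) *: z -> y = z].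

Definition pderiv (R : realType) (m d : nat) (i : 'I_m)
    (w : 'rV[R]_m -> 'rV[R]_d) : 'rV[R]_m -> 'rV[R]_d :=
  fun z => 'D_(delta_mx 0 i) w z.

(* w_{(eta)(eta)} *)
Definition dderiv2 (R : realType) (m d : nat) (w : 'rV[R]_m -> 'rV[R]_d)
    (eta z : 'rV[R]_m) : 'rV[R]_d :=
  \sum_(i < m) \sum_(j < m)
    (eta 0 i * eta 0 j) *: pderiv j (pderiv i w) z.

(* The derivability clauses are needed because 'D_v w z is a total function,
   with a junk value where the derivative does not exist. *)
Definition C2_bounded_derivs (R : realType) (m d : nat)
    (w : 'rV[R]_m -> 'rV[R]_d) : Prop :=
  (forall i : 'I_m,
     [/\ forall z, derivable w z (delta_mx 0 i),
         continuous (pderiv i w) & bounded_fun (pderiv i w)]) /\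
  (forall i j : 'I_m,
     [/\ forall z, derivable (pderiv i w) z (delta_mx 0 j),
         continuous (pderiv j (pderiv i w))
       & bounded_fun (pderiv j (pderiv i w))]).

(* Under C2_bounded_derivs and 0 < m the set below is nonempty and bounded
   above, so that sup is the genuine supremum. *)
Definition sup_dderiv2 (R : realType) (m d : nat)
    (w : 'rV[R]_m -> 'rV[R]_d) : R :=
  sup [set r | exists eta z : 'rV[R]_m,
         enorm eta = 1 /\ r = enorm (dderiv2 w eta z)].

(* Main.v *)
Require Import Defs.
From HB Require Import structures.
From mathcomp Require Import all_boot all_order all_algebra.
From mathcomp Require Import all_classical all_reals all_analysis.
From mathcomp Require Import ring lra.

(** Let [l_i(x) = b_i - <c_i, x>] be the slacks of the inequalities that define
    the polytope.

    Along a [C^2] map with values in the polytope every [sqrt (l_i (u y))] is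
    Lipschitz: a nonnegative function [p] on the line with [|p''| <= M]
    satisfies [p'^2 <= 4 M p], since its Taylor upper bound is nonnegative at
    every step size, and therefore [p (t + h) <= (sqrt (p t) + sqrt M |h|)^2]
    ([sqrt_C2_step], [sqrt_slack_lip]).  It remains to find barycentric
    coordinates [lambda_k] on the polytope, independent of [u], whose square
    roots are Lipschitz functions of the [sqrt l_i]
    ([root_barycentric]).

    Homogenising, such coordinates come from a statement about cones
    ([cone_root_generated]).  Let [K] be the set of nonnegative vectors of a
    subspace of [R^m], with the distance
    [root_dist x y = sum_i |sqrt x_i - sqrt y_i|].  Then finitely many
    [r_j] in [K] and functions [k_j >= 0] on [K] satisfy
    [x = sum_j k_j(x) r_j], with every [sqrt k_j] Lipschitz for [root_dist].
    The proof is an induction on the dimension of the subspace.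

    - Near a point [x0] of the compact slice [sum_i x_i = 1] of [K]
      ([local_conic]), only the coordinates that vanish at [x0] approach zero.
      Projecting to them loses [x0], so the dimension drops and the induction
      hypothesis applies to the projected cone.  What is left of [x] moves, near
      [x0], inside the face whose relative interior contains [x0]; there it is a
      combination of elements of [K] with coefficients that are Lipschitz and
      bounded away from zero, for which taking roots is harmless.
    - Local representations are glued by a finite partition of unity made of
      squares ([slice_conic]).  The gluing preserves the estimate because
      functions with Lipschitz square root are stable under sums and products:
      [sqrt (f^2 + g^2)] is the norm of the vector [(f, g)].
    - The representation extends from the slice to the cone by homogeneity
      ([conic_root_generated]), since both sides of the estimate scale by [s]
      when the points scale by [s^2].

    The generators obtained are points of the polytope, up to scaling; each is a
    fixed convex combination of the vertices ([hull_of_vertices]), which turns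
    the [k_j] into the [lambda_k]. *)

Set Implicit Arguments.
Unset Strict Implicit.
Unset Printing Implicit Defensive.

Import Order.TTheory GRing.Theory Num.Theory.
Import numFieldNormedType.Exports.

Local Open Scope classical_set_scope.
Local Open Scope ring_scope.

(** * Square roots of sums *)

Section SquareRoots.
Variable R : realType.
Implicit Types a b c d : R.

Lemma ler_dist_sqrt a b c : 0 < c -> c <= a -> c <= b ->
  `|Num.sqrt a - Num.sqrt b| <= (Num.sqrt c)^-1 * `|a - b|.
Proof.
move=> c0 ca cb.
have a0 := le_trans (ltW c0) ca; have b0 := le_trans (ltW c0) cb.
have sc : 0 < Num.sqrt c by rewrite sqrtr_gt0.
rewrite ler_pdivlMl //.
have -> : a - b = (Num.sqrt a + Num.sqrt b) * (Num.sqrt a - Num.sqrt b).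
  by rewrite -{1}(sqr_sqrtr a0) -{1}(sqr_sqrtr b0); ring.
rewrite normrM ler_wpM2r // ger0_norm ?addr_ge0 ?sqrtr_ge0 //.
by rewrite -[leLHS]addr0 lerD ?sqrtr_ge0 // ler_sqrt.
Qed.

(** The left side compares the Euclidean norms of the vectors
    [(sqrt a, sqrt b)] and [(sqrt c, sqrt d)], so this is the triangle
    inequality, weakened by bounding the norm of the difference by its l^1 norm. *)
Lemma dist_sqrtD a b c d : 0 <= a -> 0 <= b -> 0 <= c -> 0 <= d ->
  `|Num.sqrt (a + b) - Num.sqrt (c + d)| <=
  `|Num.sqrt a - Num.sqrt c| + `|Num.sqrt b - Num.sqrt d|.
Proof.
suff H (u v w z : R) : 0 <= u -> 0 <= v -> 0 <= w -> 0 <= z ->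
    Num.sqrt (u + v) <= Num.sqrt (w + z) +
      (`|Num.sqrt u - Num.sqrt w| + `|Num.sqrt v - Num.sqrt z|).
  move=> a0 b0 c0 d0; rewrite ler_distl; apply/andP; split.
    by rewrite lerBlDr [`|Num.sqrt a - _|]distrC [`|Num.sqrt b - _|]distrC H.
  exact: H.
move=> u0 v0 w0 z0.
set su := Num.sqrt u; set sv := Num.sqrt v; set sw := Num.sqrt w; set sz := Num.sqrt z.
have [su0 sv0 sw0 sz0] : [/\ 0 <= su, 0 <= sv, 0 <= sw & 0 <= sz].
  by split; apply: sqrtr_ge0.
set p := `|su - sw|; set q := `|sv - sz|; set r := Num.sqrt (w + z).
have r0 : 0 <= r by apply: sqrtr_ge0.
have p0 : 0 <= p by apply: normr_ge0.
have q0 : 0 <= q by apply: normr_ge0.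
have up : su <= sw + p by rewrite -lerBlDl ler_norm.
have vq : sv <= sz + q by rewrite -lerBlDl ler_norm.
have wr : sw <= r by rewrite ler_sqrt ?addr_ge0 // lerDl.
have zr : sz <= r by rewrite ler_sqrt ?addr_ge0 // lerDr.
have Hr : r ^+ 2 = sw ^+ 2 + sz ^+ 2 by rewrite !sqr_sqrtr ?addr_ge0.
have tot : 0 <= r + (p + q) by rewrite !addr_ge0.
rewrite -(ger0_norm tot) -sqrtr_sqr ler_sqrt ?sqr_ge0 //.
rewrite -(sqr_sqrtr u0) -(sqr_sqrtr v0) -/su -/sv.
have h1 : su ^+ 2 <= (sw + p) ^+ 2 by rewrite ler_sqr ?nnegrE ?addr_ge0.
have h2 : sv ^+ 2 <= (sz + q) ^+ 2 by rewrite ler_sqr ?nnegrE ?addr_ge0.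
apply: le_trans (lerD h1 h2) _.
have h3 : sw * p <= r * p by rewrite ler_wpM2r.
have h4 : sz * q <= r * q by rewrite ler_wpM2r.
have h5 : 0 <= p * q by rewrite mulr_ge0.
have -> : (r + (p + q)) ^+ 2 = r ^+ 2 + 2 * (r * p) + 2 * (r * q) +
    p ^+ 2 + q ^+ 2 + 2 * (p * q) by ring.
rewrite Hr.
have -> : (sw + p) ^+ 2 + (sz + q) ^+ 2 = sw ^+ 2 + sz ^+ 2 +
    2 * (sw * p) + 2 * (sz * q) + p ^+ 2 + q ^+ 2 by ring.
lra.
Qed.

Lemma dist_sqrt_sum (I : Type) (s : seq I) (a b : I -> R) :
  (forall i, 0 <= a i) -> (forall i, 0 <= b i) ->
  `|Num.sqrt (\sum_(i <- s) a i) - Num.sqrt (\sum_(i <- s) b i)| <=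
  \sum_(i <- s) `|Num.sqrt (a i) - Num.sqrt (b i)|.
Proof.
move=> a0 b0; elim: s => [|i s IH]; first by rewrite !big_nil subrr normr0.
rewrite !big_cons; apply: le_trans (dist_sqrtD _ _ _ _) _ => //;
  try exact: sumr_ge0.
by rewrite lerD.
Qed.

End SquareRoots.

(** * Functions with a Lipschitz square root *)

Section RootLipschitz.
Variables (R : realType) (m : nat).
Implicit Types (x y : 'rV[R]_m) (D : set 'rV[R]_m) (f g k : 'rV[R]_m -> R).

(** The distance for which the coordinates of a polytope will be Lipschitz after
    taking roots: it is finer than the usual one near the boundary of the
    orthant, where the square root has infinite slope. *)
Definition root_dist x y : R := \sum_i `|Num.sqrt (x 0 i) - Num.sqrt (y 0 i)|.

Lemma root_dist_ge0 x y : 0 <= root_dist x y.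
Proof. by apply: sumr_ge0. Qed.

Lemma root_distxx x : root_dist x x = 0.
Proof. by rewrite /root_dist big1 // => i _; rewrite subrr normr0. Qed.

Lemma root_distC x y : root_dist x y = root_dist y x.
Proof. by apply: eq_bigr => i _; rewrite distrC. Qed.

Lemma root_dist_triangle x y z : root_dist x z <= root_dist x y + root_dist y z.
Proof.
rewrite /root_dist -big_split /=; apply: ler_sum => i _.
exact: ler_distD.
Qed.

Lemma root_dist_lip x y z : `|root_dist x z - root_dist y z| <= root_dist x y.
Proof.
have := root_dist_triangle x y z; have := root_dist_triangle y x z.
by rewrite ler_norml (root_distC y x) => h1 h2; apply/andP; split; lra.
Qed.

Definition bdd_lip D f := exists2 N, 0 <= N &
  forall x y, D x -> D y -> `|f x| <= N /\ `|f x - f y| <= N * root_dist x y.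

(** Nonnegative functions that are squares of bounded Lipschitz functions, the
    distance being [root_dist]. *)
Definition root_lip D k :=
  (forall x, D x -> 0 <= k x) /\ bdd_lip D (fun x => Num.sqrt (k x)).

Lemma bdd_lip_eq D f g : (forall x, D x -> f x = g x) -> bdd_lip D f -> bdd_lip D g.
Proof.
move=> fg [N N0 fN]; exists N => // x y Dx Dy.
by rewrite -!fg //; apply: fN.
Qed.

Lemma bdd_lip_sub D D' f : D' `<=` D -> bdd_lip D f -> bdd_lip D' f.
Proof. by move=> DD [N N0 fN]; exists N => // x y /DD ? /DD ?; apply: fN. Qed.

Lemma bdd_lip_cst D c : bdd_lip D (fun=> c).
Proof.
by exists `|c| => // x y _ _; rewrite subrr normr0 mulr_ge0 ?root_dist_ge0.
Qed.

Lemma bdd_lipD D f g : bdd_lip D f -> bdd_lip D g -> bdd_lip D (fun x => f x + g x).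
Proof.
move=> [N N0 fN] [M M0 gM]; exists (N + M); first exact: addr_ge0.
move=> x y Dx Dy; have [f1 f2] := fN _ _ Dx Dy; have [g1 g2] := gM _ _ Dx Dy.
split; first by rewrite (le_trans (ler_normD _ _)) ?lerD.
by rewrite opprD addrACA mulrDl (le_trans (ler_normD _ _)) ?lerD.
Qed.

Lemma bdd_lipM D f g : bdd_lip D f -> bdd_lip D g -> bdd_lip D (fun x => f x * g x).
Proof.
move=> [N N0 fN] [M M0 gM]; exists (N * M + N * M); first by rewrite addr_ge0 ?mulr_ge0.
move=> x y Dx Dy; have [f1 f2] := fN _ _ Dx Dy; have [g1 g2] := gM _ _ Dx Dy.
have [_ _] := fN _ _ Dy Dx; have [g3 _] := gM _ _ Dy Dx.
split.
  by rewrite normrM (le_trans (ler_pM _ _ f1 g1))// lerDl mulr_ge0.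
have -> : f x * g x - f y * g y = f x * (g x - g y) + g y * (f x - f y) by ring.
rewrite (le_trans (ler_normD _ _))// mulrDl !normrM lerD//.
  by rewrite -mulrA ler_pM.
by rewrite -mulrA mulrCA ler_pM.
Qed.

Lemma bdd_lipZ D f c : bdd_lip D f -> bdd_lip D (fun x => c * f x).
Proof. by move=> ff; apply: bdd_lipM => //; apply: bdd_lip_cst. Qed.

Lemma bdd_lipN D f : bdd_lip D f -> bdd_lip D (fun x => - f x).
Proof. by move/(bdd_lipZ (-1)); apply: bdd_lip_eq => x _; rewrite mulN1r. Qed.

Lemma bdd_lip_sum D (I : Type) (s : seq I) (F : I -> 'rV[R]_m -> R) :
  (forall i, bdd_lip D (F i)) -> bdd_lip D (fun x => \sum_(i <- s) F i x).
Proof.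
move=> FF; elim: s => [|i s IH].
  by apply: (bdd_lip_eq _ (bdd_lip_cst D 0)) => x _; rewrite big_nil.
by apply: (bdd_lip_eq _ (bdd_lipD (FF i) IH)) => x _; rewrite big_cons.
Qed.

Lemma bdd_lipV D f c : 0 < c -> (forall x, D x -> c <= f x) -> bdd_lip D f ->
  bdd_lip D (fun x => (f x)^-1).
Proof.
move=> c0 cf [N N0 fN].
exists (c^-1 + N * c^-1 * c^-1).
  by rewrite addr_ge0 ?mulr_ge0 ?invr_ge0 // ltW.
move=> x y Dx Dy; have [_ f2] := fN _ _ Dx Dy.
have fx := lt_le_trans c0 (cf _ Dx); have fy := lt_le_trans c0 (cf _ Dy).
have fVx : (f x)^-1 <= c^-1 by rewrite lef_pV2 ?posrE ?cf.
have fVy : (f y)^-1 <= c^-1 by rewrite lef_pV2 ?posrE ?cf.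
have cV : 0 <= c^-1 by rewrite invr_ge0 ltW.
split.
  by rewrite gtr0_norm ?invr_gt0 // (le_trans fVx) // lerDl !mulr_ge0.
have -> : (f x)^-1 - (f y)^-1 = (f y - f x) * (f x)^-1 * (f y)^-1.
  by field; rewrite !gt_eqF.
rewrite !normrM distrC mulrDl ler_wpDl ?mulr_ge0 ?root_dist_ge0 //.
have -> : N * c^-1 * c^-1 * root_dist x y = N * root_dist x y * c^-1 * c^-1 by ring.
rewrite [`|(f x)^-1|]gtr0_norm ?invr_gt0 // [`|(f y)^-1|]gtr0_norm ?invr_gt0 //.
have VX : 0 <= (f x)^-1 by rewrite invr_ge0 ltW.
have VY : 0 <= (f y)^-1 by rewrite invr_ge0 ltW.
by apply: ler_pM => //; [apply: mulr_ge0|apply: ler_pM].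
Qed.

Lemma bdd_lip_sqrt D f c : 0 < c -> (forall x, D x -> c <= f x) -> bdd_lip D f ->
  bdd_lip D (fun x => Num.sqrt (f x)).
Proof.
move=> c0 cf [N N0 fN].
exists (Num.sqrt N + (Num.sqrt c)^-1 * N).
  by rewrite addr_ge0 ?mulr_ge0 ?invr_ge0 ?sqrtr_ge0.
move=> x y Dx Dy; have [f1 f2] := fN _ _ Dx Dy; split.
  rewrite ger0_norm ?sqrtr_ge0 // ler_wpDr ?mulr_ge0 ?invr_ge0 ?sqrtr_ge0 //.
  by rewrite ler_sqrt // (le_trans _ f1) // ler_norm.
rewrite mulrDl ler_wpDl ?mulr_ge0 ?root_dist_ge0 ?sqrtr_ge0 //.
apply: le_trans (ler_dist_sqrt c0 (cf _ Dx) (cf _ Dy)) _.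
by rewrite -mulrA ler_wpM2l // invr_ge0 sqrtr_ge0.
Qed.

Lemma root_lip_eq D k k' : (forall x, D x -> k x = k' x) -> root_lip D k -> root_lip D k'.
Proof.
move=> kk' [k0 kl]; split=> [x Dx|]; first by rewrite -kk' // k0.
by apply: bdd_lip_eq kl => x Dx; rewrite kk'.
Qed.

Lemma root_lip_sub D D' k : D' `<=` D -> root_lip D k -> root_lip D' k.
Proof.
by move=> DD [k0 kl]; split=> [x /DD|]; [exact: k0|exact: bdd_lip_sub kl].
Qed.

Lemma root_lip_blip D k : root_lip D k -> bdd_lip D k.
Proof.
move=> [k0 kl]; apply: bdd_lip_eq (bdd_lipM kl kl) => x Dx.
by rewrite -expr2 sqr_sqrtr ?k0.
Qed.

Lemma root_lip_sqr D f : bdd_lip D f -> root_lip D (fun x => f x ^+ 2).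
Proof.
move=> [N N0 fN]; split=> [x _|]; first exact: sqr_ge0.
exists N => // x y Dx Dy; rewrite !sqrtr_sqr normr_id.
have [f1 f2] := fN _ _ Dx Dy; split=> //.
exact: le_trans (ler_dist_dist _ _) f2.
Qed.

(** Away from zero the square root is itself Lipschitz, so only the zeros of a
    coefficient have to be controlled. *)
Lemma root_lip_pos D f c : 0 < c -> (forall x, D x -> c <= f x) -> bdd_lip D f -> root_lip D f.
Proof.
move=> c0 cf ff; split; last exact: (bdd_lip_sqrt c0 cf ff).
by move=> x /cf cx; apply: le_trans (ltW c0) cx.
Qed.

Lemma root_lip_cst D c : 0 <= c -> root_lip D (fun=> c).
Proof. by move=> c0; split=> //; apply: bdd_lip_cst. Qed.

Lemma root_lipM D k k' : root_lip D k -> root_lip D k' -> root_lip D (fun x => k x * k' x).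
Proof.
move=> [k0 kl] [k0' kl']; split=> [x Dx|]; first by rewrite mulr_ge0 ?k0 ?k0'.
by apply: bdd_lip_eq (bdd_lipM kl kl') => x Dx; rewrite sqrtrM ?k0.
Qed.

Lemma root_lipV D k c : 0 < c -> (forall x, D x -> c <= k x) -> root_lip D k ->
  root_lip D (fun x => (k x)^-1).
Proof.
move=> c0 ck [k0 kl]; split=> [x Dx|]; first by rewrite invr_ge0 k0.
have c0' : 0 < Num.sqrt c by rewrite sqrtr_gt0.
apply: bdd_lip_eq (bdd_lipV c0' _ kl) => x Dx; first by rewrite sqrtrV ?k0.
by rewrite ler_sqrt ?ck // k0.
Qed.

Lemma root_lipD D k k' : root_lip D k -> root_lip D k' -> root_lip D (fun x => k x + k' x).
Proof.
move=> [k0 [N N0 kN]] [k0' [M M0 kM]]; split=> [x Dx|].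
  by rewrite addr_ge0 ?k0 ?k0'.
exists (N + M); first exact: addr_ge0.
move=> x y Dx Dy.
have [f1 f2] := kN _ _ Dx Dy; have [g1 g2] := kM _ _ Dx Dy; split.
  have := dist_sqrtD (k0 _ Dx) (k0' _ Dx) (lexx 0) (lexx 0).
  by rewrite addr0 sqrtr0 !subr0 => /le_trans; apply; apply: lerD.
apply: le_trans (dist_sqrtD _ _ _ _) _; rewrite ?k0 ?k0' //.
by rewrite mulrDl lerD.
Qed.

Lemma root_lip_sum D (I : eqType) (s : seq I) (F : I -> 'rV[R]_m -> R) :
  (forall i, i \in s -> root_lip D (F i)) ->
  root_lip D (fun x => \sum_(i <- s) F i x).
Proof.
elim: s => [|i s IH] FF.
  by apply: (root_lip_eq _ (root_lip_cst D (lexx 0))) => x _; rewrite big_nil.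
have FFs : root_lip D (fun x => \sum_(j <- s) F j x).
  by apply: IH => j js; apply: FF; rewrite inE js orbT.
apply: (root_lip_eq _ (root_lipD (FF i (mem_head _ _)) FFs)) => x _.
by rewrite big_cons.
Qed.

(** A cut-off supported in the [root_dist]-ball of radius [e], Lipschitz because
    [root_dist] satisfies the triangle inequality. *)
Definition bump (e : R) (x0 x : 'rV[R]_m) : R := Num.max 0 (e - root_dist x x0).

Lemma bump_ge0 e x0 x : 0 <= bump e x0 x.
Proof. by rewrite /bump le_max lexx. Qed.

Lemma bump_lip e x0 x y : `|bump e x0 x - bump e x0 y| <= root_dist x y.
Proof.
have := root_dist_lip x y x0; have := root_dist_ge0 x y; rewrite /bump.
case: (leP 0 (e - root_dist x x0)); case: (leP 0 (e - root_dist y x0)) => h1 h2;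
  rewrite !ler_norml => h3 /andP[h4 h5]; apply/andP; split; lra.
Qed.

Lemma bdd_lip_bump D e x0 : 0 <= e -> bdd_lip D (bump e x0).
Proof.
move=> e0; exists (e + 1); first by rewrite addr_ge0.
move=> x y _ _; split.
  rewrite ger0_norm ?bump_ge0 // ge_max addr_ge0 //=.
  by have := root_dist_ge0 x x0; lra.
by apply: le_trans (bump_lip e x0 x y) _; have := root_dist_ge0 x y; nra.
Qed.

Definition root_ball D e x0 : set 'rV[R]_m := D `&` [set x | root_dist x x0 < e].

(** Extension by zero of a function that is controlled only near [x0].  Between
    a point [x] of the ball and a point [y] outside, the root of the product
    jumps by at most a constant times the bump at [x], and the bump at [x] is at
    most [root_dist x y] because it vanishes at [y]. *)
Lemma root_lip_bump D e x0 k : 0 <= e -> root_lip (root_ball D e x0) k ->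
  exists2 k', root_lip D k' & forall x, D x -> k' x = bump e x0 x ^+ 2 * k x.
Proof.
move=> e0 [k0 [N N0 kN]].
have out x : ~ (root_dist x x0 < e) -> bump e x0 x = 0.
  by rewrite /bump => /negP; rewrite -leNgt => h; rewrite max_l // subr_le0.
have kk x : D x -> 0 <= bump e x0 x ^+ 2 * k x.
  move=> Dx; have [h|/out->] := pselect (root_dist x x0 < e); last by rewrite expr0n /= mul0r.
  by rewrite mulr_ge0 ?sqr_ge0 ?k0.
exists (fun x => bump e x0 x ^+ 2 * k x) => //; split => //.
have E x : Num.sqrt (bump e x0 x ^+ 2 * k x) = bump e x0 x * Num.sqrt (k x).
  by rewrite sqrtrM ?sqr_ge0 // sqrtr_sqr ger0_norm ?bump_ge0.
have [M M0 bM] := bdd_lip_bump D x0 e0.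
exists (M * N + N + M * N); first by rewrite !addr_ge0 ?mulr_ge0.
(* One point inside the ball and one outside. *)
have half x y : D x -> D y -> root_dist x x0 < e -> ~ (root_dist y x0 < e) ->
   `|bump e x0 x * Num.sqrt (k x)| <= N * root_dist x y.
  move=> Dx Dy hx /out hy; rewrite normrM mulrC.
  have [h1 _] := kN x x (conj Dx hx) (conj Dx hx).
  rewrite ler_pM //; have := bump_lip e x0 x y; by rewrite hy subr0.
move=> x y Dx Dy; rewrite !E; split.
  have [hx|/out->] := pselect (root_dist x x0 < e); last first.
    by rewrite mul0r normr0 !addr_ge0 ?mulr_ge0.
  have [h1 _] := kN x x (conj Dx hx) (conj Dx hx).
  have [h2 _] := bM x x Dx Dx.
  rewrite normrM -[leLHS]addr0 lerD ?mulr_ge0 //.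
  by rewrite -[leLHS]addr0 lerD ?ler_pM.
have NN : N * root_dist x y <= (M * N + N + M * N) * root_dist x y.
  by rewrite ler_wpM2r ?root_dist_ge0 // -addrA addrCA lerDl addr_ge0 ?mulr_ge0.
have [hx|hx] := pselect (root_dist x x0 < e); have [hy|hy] := pselect (root_dist y x0 < e).
- have [h1 h2] := kN x y (conj Dx hx) (conj Dy hy).
  have [h3 _] := bM x y Dx Dy.
  have [h4 _] := kN y x (conj Dy hy) (conj Dx hx).
  have -> : bump e x0 x * Num.sqrt (k x) - bump e x0 y * Num.sqrt (k y) =
    bump e x0 x * (Num.sqrt (k x) - Num.sqrt (k y)) +
    (bump e x0 x - bump e x0 y) * Num.sqrt (k y).
    by ring.
  apply: le_trans (ler_normD _ _) _; rewrite !normrM.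
  have h5 := ler_pM (normr_ge0 _) (normr_ge0 _) h3 h2.
  have h6 := ler_pM (normr_ge0 _) (normr_ge0 _) (bump_lip e x0 x y) h4.
  apply: le_trans (lerD h5 h6) _.
  rewrite !mulrDl [root_dist x y * N]mulrC -mulrA lerDl !mulr_ge0 ?root_dist_ge0 //.
- by rewrite (out y) // mul0r subr0; apply: le_trans NN; apply: half.
- rewrite (out x) // mul0r sub0r normrN; apply: le_trans NN.
  by rewrite root_distC; apply: half.
- by rewrite (out x) // (out y) // !mul0r subrr normr0 mulr_ge0 ?root_dist_ge0 // !addr_ge0 ?mulr_ge0.
Qed.

End RootLipschitz.

(** * Conic combinations with root-Lipschitz coefficients *)

Section Conic.
Variables (R : realType) (m : nat).
Implicit Types (x y : 'rV[R]_m) (K D : set 'rV[R]_m) (F : 'rV[R]_m -> 'rV[R]_m).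

(** Maps that are finite combinations of elements of [K] with root-Lipschitz
    coefficients.  General maps, rather than the identity alone, make the notion
    closed under sums and under multiplication by a weight, so that
    representations of the identity can be assembled and glued. *)
Definition conic K D F :=
  exists (J : finType) (r : J -> 'rV[R]_m) (k : J -> 'rV[R]_m -> R),
    [/\ forall j, K (r j), forall j, root_lip D (k j)
      & forall x, D x -> F x = \sum_j k j x *: r j].

Lemma conic_eq K D F G : (forall x, D x -> F x = G x) -> conic K D F -> conic K D G.
Proof.
move=> FG [J [r [k [Kr sk Fk]]]]; exists J, r, k; split=> // x Dx.
by rewrite -FG // Fk.
Qed.

Lemma conic_term K D k r : root_lip D k -> K r -> conic K D (fun x => k x *: r).
Proof.
move=> sk Kr; exists unit, (fun=> r), (fun=> k); split=> // x _.
by rewrite (big_pred1 tt) //; case.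
Qed.

Lemma conic0 K D : conic K D (fun=> 0).
Proof.
exists void, (fun=> 0), (fun _ _ => 0); split; try by case.
by move=> x _; rewrite big1 //; case.
Qed.

Lemma conicD K D F G : conic K D F -> conic K D G -> conic K D (fun x => F x + G x).
Proof.
move=> [J [r [k [Kr sk Fk]]]] [J' [r' [k' [Kr' sk' Fk']]]].
exists (J + J')%type, (fun j => match j with inl j => r j | inr j => r' j end),
  (fun j => match j with inl j => k j | inr j => k' j end).
split; try by case.
by move=> x Dx; rewrite big_sumType /= Fk // Fk'.
Qed.

Lemma conic_sum K D (I : eqType) (s : seq I) (F : I -> 'rV[R]_m -> 'rV[R]_m) :
  (forall i, i \in s -> conic K D (F i)) ->
  conic K D (fun x => \sum_(i <- s) F i x).
Proof.
elim: s => [|i s IH] FF.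
  by apply: (conic_eq _ (conic0 K D)) => x _; rewrite big_nil.
have FFs : conic K D (fun x => \sum_(j <- s) F j x).
  by apply: IH => j js; apply: FF; rewrite inE js orbT.
apply: (conic_eq _ (conicD (FF i (mem_head _ _)) FFs)) => x _.
by rewrite big_cons.
Qed.

Lemma conicZ K D F k : root_lip D k -> conic K D F -> conic K D (fun x => k x *: F x).
Proof.
move=> sk [J [r [k' [Kr sk' Fk]]]].
exists J, r, (fun j x => k x * k' j x); split=> // [j|x Dx]; first exact: root_lipM.
by rewrite Fk // scaler_sumr; apply: eq_bigr => j _; rewrite scalerA.
Qed.

Lemma conic_bump K D e x0 F : 0 <= e -> conic K (root_ball D e x0) F ->
  conic K D (fun x => bump e x0 x ^+ 2 *: F x).
Proof.
move=> e0 [J [r [k [Kr sk Fk]]]].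
have /choice[k' k'P] (j : J) : exists k', root_lip D k' /\
    forall x, D x -> k' x = bump e x0 x ^+ 2 * k j x.
  by have [k' ? ?] := root_lip_bump e0 (sk j); exists k'.
exists J, r, k'; split=> // [j|x Dx]; first by have [] := k'P j.
under eq_bigr do rewrite (proj2 (k'P _)) // -scalerA.
rewrite -scaler_sumr; have [h|h] := pselect (root_dist x x0 < e); first by rewrite Fk.
suff -> : bump e x0 x = 0 by rewrite expr0n /= !scale0r.
by move/negP: h; rewrite -leNgt => h; rewrite /bump max_l // subr_le0.
Qed.

(** A vector that is positive outside its zero set absorbs any finite family of
    perturbations that are nonnegative on that zero set. *)
Lemma dominating (J : finType) (h : J -> 'rV[R]_m) (x0 : 'rV[R]_m) :
  (forall i, 0 <= x0 0 i) -> (forall i, x0 0 i = 0 -> forall j, 0 <= h j 0 i) ->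
  exists2 M, 0 < M & forall j i, 0 <= (M *: x0 + h j) 0 i.
Proof.
move=> x00 hx.
pose t j i := `|h j 0 i| / x0 0 i.
have t0 j i : 0 <= t j i by rewrite divr_ge0.
exists (1 + \sum_j \sum_i t j i).
  by rewrite ltr_pwDl // sumr_ge0 // => j _; rewrite sumr_ge0.
move=> j i; rewrite !mxE.
have [xi|xi] := eqVneq (x0 0 i) 0; first by rewrite xi mulr0 add0r hx.
have xp : 0 < x0 0 i by rewrite lt_neqAle eq_sym xi x00.
have le1 : t j i <= 1 + \sum_j \sum_i t j i.
  rewrite (bigD1 j) //= (bigD1 i) //= addrA addrA.
  have : 0 <= \sum_(i0 < m | i0 != i) t j i0 by apply: sumr_ge0.
  have : 0 <= \sum_(j0 | j0 != j) \sum_i t j0 i.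
    by apply: sumr_ge0 => j' _; apply: sumr_ge0.
  by move: (t0 j i); lra.
have : `|h j 0 i| <= (1 + \sum_j \sum_i t j i) * x0 0 i.
  by rewrite -ler_pdivrMr.
by rewrite ler_norml => /andP[? _]; lra.
Qed.

(** * Local representations in a polyhedral cone *)

(** The row space of [C] intersected with the nonnegative orthant; every pointed
    polyhedral cone is of this form up to a linear isomorphism, its coordinates
    being its slacks. *)
Definition cone q (C : 'M[R]_(q, m)) : set 'rV[R]_m :=
  [set x | (x <= C)%MS /\ forall i, 0 <= x 0 i].

Definition slice q (C : 'M[R]_(q, m)) : set 'rV[R]_m :=
  cone C `&` [set x | \sum_i x 0 i = 1].

(** The Lipschitz bound is required on the whole cone, where the coefficients are
    unbounded, and not only on its slice: the induction applies it at points
    whose projection to some coordinates tends to zero. *)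
Definition root_generated q (C : 'M[R]_(q, m)) :=
  exists (J : finType) (r : J -> 'rV[R]_m) (k : J -> 'rV[R]_m -> R) (N : R),
    [/\ forall j, cone C (r j),
        forall j x, cone C x -> 0 <= k j x,
        forall j, k j 0 = 0,
        0 <= N /\ forall j x y, cone C x -> cone C y ->
          `|Num.sqrt (k j x) - Num.sqrt (k j y)| <= N * root_dist x y
      & forall x, cone C x -> x = \sum_j k j x *: r j].

Lemma coneZ q (C : 'M[R]_(q, m)) x a : 0 <= a -> cone C x -> cone C (a *: x).
Proof.
move=> a0 [xC x0]; split; first exact: scalemx_sub.
by move=> i; rewrite mxE mulr_ge0.
Qed.

Lemma cone0 q (C : 'M[R]_(q, m)) : cone C 0.
Proof. by split; [exact: sub0mx|move=> i; rewrite mxE]. Qed.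

Lemma slice_le1 q (C : 'M[R]_(q, m)) x i : slice C x -> x 0 i <= 1.
Proof.
move=> [[_ x0] /= <-]; rewrite (bigD1 i) //= lerDl sumr_ge0 // => j _.
Qed.

Lemma root_lip_coord q (C : 'M[R]_(q, m)) i : root_lip (slice C) (fun x => x 0 i).
Proof.
split=> [x [[_ x0] _]|]; first exact: x0.
exists 1 => // x y Dx Dy; split.
  by rewrite ger0_norm ?sqrtr_ge0 // -sqrtr1 ler_sqrt // (slice_le1 i Dx).
by rewrite mul1r /root_dist (bigD1 i) //= lerDl sumr_ge0.
Qed.

(** The projection to the coordinates that vanish at [x0], written as a mask so
    that the projected cone stays in the same space and no reindexing occurs. *)
Definition zero_mask (x0 : 'rV[R]_m) : 'M[R]_m :=
  diag_mx (\row_i (x0 0 i == 0)%:R).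

Lemma mul_zero_mask x0 q (A : 'M[R]_(q, m)) i j :
  (A *m zero_mask x0) i j = if x0 0 j == 0 then A i j else 0.
Proof. by rewrite mul_mx_diag !mxE; case: eqP; rewrite ?mulr1 ?mulr0. Qed.

Lemma root_dist_mask x0 x y :
  root_dist (x *m zero_mask x0) (y *m zero_mask x0) <= root_dist x y.
Proof.
apply: ler_sum => i _; rewrite !mul_zero_mask.
by case: eqP => _ //; rewrite subrr normr0.
Qed.

Lemma mask_cone q (C : 'M[R]_(q, m)) x0 x :
  cone C x -> cone (C *m zero_mask x0) (x *m zero_mask x0).
Proof.
move=> [xC x0']; split; first exact: submxMr.
by move=> i; rewrite mul_zero_mask; case: ifP.
Qed.

Lemma root_lip_masked q (C : 'M[R]_(q, m)) x0 k N :
  let C' := C *m zero_mask x0 in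
  0 <= N -> k 0 = 0 -> (forall x, cone C' x -> 0 <= k x) ->
  (forall x y, cone C' x -> cone C' y ->
     `|Num.sqrt (k x) - Num.sqrt (k y)| <= N * root_dist x y) ->
  root_lip (slice C) (fun x => k (x *m zero_mask x0)).
Proof.
move=> C' N0 k00 k0 kN; split=> [x [Cx _]|]; first by rewrite k0 //; apply: mask_cone.
exists (N * (1 + m%:R)); first by rewrite mulr_ge0 // addr_ge0.
move=> x y Dx Dy; have [Cx _] := Dx; have [Cy _] := Dy; split.
  have := kN _ _ (mask_cone x0 Cx) (cone0 C').
  rewrite k00 sqrtr0 subr0 => /le_trans; apply; rewrite ler_wpM2l //.
  apply: (@le_trans _ _ (\sum_(i < m) 1)); last first.
    by rewrite sumr_const card_ord lerDr.
  apply: ler_sum => i _; rewrite [(0 : 'rV_m) 0 i]mxE sqrtr0 subr0 ger0_norm ?sqrtr_ge0 //.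
  rewrite mul_zero_mask -sqrtr1 ler_sqrt //.
  by case: eqP => _; [rewrite (slice_le1 i Dx)|rewrite ler01].
apply: le_trans (kN _ _ (mask_cone x0 Cx) (mask_cone x0 Cy)) _.
rewrite -mulrA ler_wpM2l //.
apply: le_trans (root_dist_mask x0 x y) _.
have := root_dist_ge0 x y; rewrite mulrDl mul1r lerDl => h; exact: mulr_ge0.
Qed.

(** Write [r' j] for a lift to the cone of the generators of the masked cone,
    corrected by a multiple of [x0] to be nonnegative.  Subtracting
    [sum_j k' j x *: r' j] from [x] leaves a vector with the same zero
    coordinates as [x0] and close to [x0].  It differs from [x0] by a vector [g x]
    of the linear span [L0] of the face of [x0], and moving from [x0] in the
    directions of [L0] stays in the cone for a while in both senses. *)
Lemma local_conic q (C : 'M[R]_(q, m)) x0 :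
  slice C x0 -> root_generated (C *m zero_mask x0) ->
  exists2 e, 0 < e & conic (cone C) (root_ball (slice C) e x0) id.
Proof.
move=> Dx0 [J [r [k [N [rC k0 k00 [N0 kN] kE]]]]].
have [Cx0 /= sx0] := Dx0; have [x0C x00] := Cx0.
have m0 : (0 < m)%N.
  case: (posnP m) => // mz; move: sx0; rewrite big1 => [/eqP|i _].
    by rewrite eq_sym oner_eq0.
  by have := leq_trans (ltn_ord i) (eq_leq mz).
set D0 := zero_mask x0 in rC k0 kN kE.
(* Lifting the generators of the masked cone to the row space of [C]. *)
have /choice[z zE] (j : J) : exists z, r j = z *m (C *m D0).
  by have [/submxP[z ->] _] := rC j; exists z.
have [M M0 rM] : exists2 M, 0 < M & forall j i, 0 <= (M *: x0 + z j *m C) 0 i.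
  apply: dominating => // i xi j.
  have [_ /(_ i)] := rC j; by rewrite zE mulmxA mul_zero_mask xi eqxx.
pose r' j := M *: x0 + z j *m C.
have r'C j : cone C (r' j).
  split; last exact: rM.
  by rewrite addmx_sub ?scalemx_sub // submxMl.
have x0D0 : x0 *m D0 = 0.
  by apply/rowP => i; rewrite mul_zero_mask mxE; case: eqP.
have r'D0 j : r' j *m D0 = r j.
  by rewrite /r' mulmxDl -scalemxAl x0D0 scaler0 add0r zE mulmxA.
pose k' j x := k j (x *m D0).
have sk' j : root_lip (slice C) (k' j) by apply: (root_lip_masked N0 (k00 j) (k0 j) (kN j)).
(* What remains of [x], measured from [x0]. *)
pose g x := x - \sum_j k' j x *: r' j - x0.
pose L0 := (C :&: kermx D0)%MS.
have gL0 x : slice C x -> (g x <= L0)%MS.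
  move=> [Cx _]; rewrite sub_capmx; apply/andP; split.
    rewrite /g !addmx_sub ?eqmx_opp //; first by case: Cx.
    by apply: summx_sub => j _; rewrite scalemx_sub //; case: (r'C j).
  apply/sub_kermxP; rewrite /g !mulmxBl x0D0 subr0 mulmx_suml.
  under eq_bigr do rewrite -scalemxAl r'D0.
  by rewrite -(kE _ (mask_cone x0 Cx)) subrr.
(* These vectors of [L0] reproduce every vector of [L0] from its own
   coordinates, so the coefficients below are coordinates of [g x]. *)
pose f i := row i (pinvmx L0 *m L0).
have fL0 i : (f i <= L0)%MS by rewrite /f row_mul submxMl.
have fC i : (f i <= C)%MS by apply: submx_trans (fL0 i) (capmxSl _ _).
have f0 i l : x0 0 l = 0 -> f i 0 l = 0.
  move=> xl; have /sub_kermxP/rowP/(_ l) := submx_trans (fL0 i) (capmxSr _ _).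
  by rewrite mul_zero_mask xl eqxx => ->; rewrite mxE.
have gE x : slice C x -> g x = \sum_i g x 0 i *: f i.
  by move=> /gL0 /mulmxKpV {1}<-; rewrite -mulmxA mulmx_sum_row.
have [A A0 fA] : exists2 A, 0 < A & forall (j : 'I_m * bool) i,
    0 <= (A *: x0 + (-1) ^+ j.2 *: f j.1) 0 i.
  by apply: dominating => // i xi j; rewrite mxE f0 // mulr0.
pose h (s : bool) i := A *: x0 + (-1) ^+ s *: f i.
have hC s i : cone C (h s i).
  split; last by move=> l; apply: (fA (i, s)).
  by rewrite addmx_sub ?scalemx_sub.
(* Since [h false i + h true i = 2 * A *: x0], giving all the [2 * m] vectors
   [h s i] the same weight [c] recovers [x0]. *)
pose c := (2 * m%:R * A)^-1.
have mR : 0 < m%:R :> R by rewrite ltr0n.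
have c0 : 0 < c by rewrite invr_gt0 !mulr_gt0.
have bg i : bdd_lip (slice C) (fun x => g x 0 i).
  apply: (@bdd_lip_eq _ _ _ (fun x => x 0 i + - (\sum_j r' j 0 i * k' j x) + - x0 0 i)).
    move=> x _; rewrite /g !mxE summxE; congr (_ - _ - _).
    by apply: eq_bigr => j _; rewrite !mxE mulrC.
  apply: bdd_lipD; last exact: bdd_lip_cst.
  apply: bdd_lipD; first exact/root_lip_blip/root_lip_coord.
  by apply/bdd_lipN/bdd_lip_sum => j; apply/bdd_lipZ/root_lip_blip.
have gx0 i : g x0 0 i = 0.
  rewrite /g !mxE summxE big1 ?subr0 ?subrr // => j _.
  by rewrite /k' x0D0 k00 scale0r mxE.
have /choice[B BP] (i : 'I_m) : exists B, 0 <= B /\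
    forall x, slice C x -> `|g x 0 i| <= B * root_dist x x0.
  have [B B0 gB] := bg i; exists B; split=> // x Dx.
  by have [_] := gB x x0 Dx Dx0; rewrite gx0 subr0.
pose S := 1 + \sum_i B i.
have S0 : 0 < S by rewrite ltr_pwDl // sumr_ge0 // => i _; case: (BP i).
(* On the ball of this radius [|g x 0 i| <= c], which keeps the weights [w s i]
   at least [c / 2]. *)
pose e := c / S.
have e0 : 0 < e by rewrite divr_gt0.
exists e => //.
have gc x i : root_ball (slice C) e x0 x -> `|g x 0 i| <= c.
  move=> [Dx /= xe]; apply: le_trans (proj2 (BP i) _ Dx) _.
  have -> : c = S * e by rewrite /e mulrCA divff ?mulr1 // gt_eqF.
  apply: ler_pM; [by case: (BP i)|exact: root_dist_ge0| |exact: ltW].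
  rewrite /S (bigD1 i) //= addrCA lerDl addr_ge0 // sumr_ge0 // => l _.
  by case: (BP l).
have ballS : root_ball (slice C) e x0 `<=` slice C by move=> x [].
pose w (s : bool) i x := c + 2^-1 * (-1) ^+ s * g x 0 i.
have sw s i : root_lip (root_ball (slice C) e x0) (w s i).
  apply: (@root_lip_pos _ _ _ _ (c / 2)); rewrite ?divr_gt0 //.
    move=> x /gc -/(_ i); rewrite /w ler_norml => /andP[? ?].
    by case: s; rewrite ?expr1 ?expr0; lra.
  by apply/bdd_lipD/bdd_lipZ/(bdd_lip_sub ballS)/bg; apply: bdd_lip_cst.
apply: (@conic_eq _ _ (fun x => \sum_j k' j x *: r' j +
    (\sum_i w false i x *: h false i + \sum_i w true i x *: h true i))); last first.
  apply: conicD; last apply: conicD.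
  - by apply: conic_sum => j _; apply: conic_term => //; apply: root_lip_sub (sk' j).
  - by apply: conic_sum => i _; apply: conic_term.
  - by apply: conic_sum => i _; apply: conic_term.
move=> x [Dx _] /=.
have xE : x = \sum_j k' j x *: r' j + (x0 + g x).
  by rewrite /g [x0 + _]addrC subrK addrC subrK.
rewrite [RHS]xE; congr (_ + _); rewrite -big_split /= [in RHS](gE _ Dx).
have x0E : x0 = \sum_(i < m) (2 * c * A) *: x0.
  rewrite sumr_const card_ord -scaler_nat scalerA.
  have -> : m%:R * (2 * c * A) = 1 by rewrite /c; field; rewrite !gt_eqF.
  by rewrite scale1r.
rewrite {1}x0E -big_split /=; apply: eq_bigr => i _.
rewrite /w /h !expr1 !expr0; apply/rowP => l; rewrite !mxE.
by field.
Qed.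
End Conic.

(** * Global representations in a polyhedral cone *)

Lemma pos_lower_bound (R : realType) (I : eqType) (s : seq I) (a : I -> R) :
  (forall i, i \in s -> 0 < a i) ->
  exists2 c, 0 < c & forall i, i \in s -> c <= a i.
Proof.
elim: s => [|i s IH] a0; first by exists 1.
have [|c c0 ca] := IH; first by move=> j js; rewrite a0 // inE js orbT.
exists (Num.min (a i) c); first by rewrite lt_min c0 a0 ?mem_head.
move=> j; rewrite inE => /orP[/eqP->|/ca h]; rewrite ge_min ?lexx //.
by rewrite h orbT.
Qed.

Lemma continuous_sum (R : realType) (T : topologicalType) (I : Type) (s : seq I) (F : I -> T -> R) :
  (forall i, continuous (F i)) -> continuous (fun t => \sum_(i <- s) F i t).
Proof.
move=> cF; elim: s => [|i s IH] t.
  under eq_fun do rewrite big_nil; exact: cvg_cst.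
under eq_fun do rewrite big_cons; apply: cvgD; [exact: cF|exact: IH].
Qed.

Section ConeTheorem.
Variables (R : realType) (m : nat).
Implicit Types x y : 'rV[R]_m.

Lemma continuous_root_dist (x0 : 'rV[R]_m) : continuous (fun x => root_dist x x0).
Proof.
apply: (@continuous_sum R 'rV[R]_m) => i x.
have cx : (fun y : 'rV[R]_m => Num.sqrt (y 0 i)) @ x --> Num.sqrt (x 0 i).
  apply: (@continuous_comp _ _ _ (fun y : 'rV[R]_m => y 0 i) Num.sqrt).
    exact: coord_continuous.
  exact: sqrt_continuous.
exact: (cvg_norm (cvgB cx (cvg_cst _))).
Qed.

Lemma compact_slice q (C : 'M[R]_(q, m)) : compact (slice C).
Proof.
apply: bounded_closed_compact.
  exists 1; split=> // B B1 x Dx; rewrite /= -[`|x|]/(mx_norm x) mx_normrE.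
  apply: bigmax_le => [|[i j] _ /=]; first by rewrite (le_trans _ (ltW B1)).
  have [[_ x0] _] := Dx; rewrite ord1 ger0_norm //.
  exact: le_trans (slice_le1 j Dx) (ltW B1).
have lin (a : 'I_m -> R) : continuous (fun x : 'rV[R]_m => \sum_i x 0 i * a i).
  apply: (@continuous_sum R 'rV[R]_m) => i x.
  exact: (cvgM (@coord_continuous _ _ _ 0 i x) (cvg_cst _)).
have -> : slice C =
    (\bigcap_(j in @setT 'I_m) [set x : 'rV[R]_m | \sum_i x 0 i * cokermx C i j = 0]) `&`
    (\bigcap_(j in @setT 'I_m) [set x : 'rV[R]_m | 0 <= x 0 j]) `&`
    [set x : 'rV[R]_m | \sum_i x 0 i * 1 = 1].
  apply/seteqP; split=> x.
    move=> [[xC x0] /= x1]; split; last first.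
      by rewrite /= -[RHS]x1; apply: eq_bigr => i _; rewrite mulr1.
    split=> j _ /=; last exact: x0.
    by move: xC; rewrite submxE => /eqP/rowP/(_ j); rewrite !mxE.
  move=> [[xC x0] /= x1]; split; last first.
    by rewrite /= -[RHS]x1; apply: eq_bigr => i _; rewrite mulr1.
  split=> [|i]; last exact: (x0 i I).
  by rewrite submxE; apply/eqP/rowP => j; rewrite !mxE; apply: (xC j I).
apply: closedI; first apply: closedI.
- apply: closed_bigI => j _.
  exact: (proj1 (continuous_closedP _) (lin (fun i => cokermx C i j))
    [set y : R | y = 0] (@closed_eq R 0)).
- apply: closed_bigI => j _.
  apply: (proj1 (continuous_closedP (fun x : 'rV[R]_m => x 0 j)) _
    [set y | 0 <= y] (@closed_ge _ _)).
  exact: coord_continuous.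
- exact: (proj1 (continuous_closedP _) (lin (fun=> 1)) [set y : R | y = 1] (@closed_eq R 1)).
Qed.

(** Gluing with the weights [bump^2 / W], where [W] is the sum of the squared
    bumps over a finite cover and is bounded below on the slice. *)
Lemma slice_conic q (C : 'M[R]_(q, m)) :
  (forall x0, slice C x0 ->
     exists2 e, 0 < e & conic (cone C) (root_ball (slice C) e x0) id) ->
  conic (cone C) (slice C) id.
Proof.
move=> loc.
have /choice[e eP] (t : 'rV[R]_m) : exists e : R, slice C t ->
    0 < e /\ conic (cone C) (root_ball (slice C) e t) id.
  have [/loc[e e0 ce]|nt] := pselect (slice C t); first by exists e.
  by exists 0 => /nt.
have [] := (eq_ind _ (fun P => P (slice C)) (@compact_slice q C) _
    (compact_cover _)) _ (slice C) (fun t => [set x | root_dist x t < e t / 2]).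
- move=> t _; apply: (@open_comp _ _ (fun x => root_dist x t) [set y | y < e t / 2]).
    by move=> x _; apply: continuous_root_dist.
  exact: open_lt.
- move=> x Dx; exists x => //=; rewrite root_distxx divr_gt0 //.
  by have [] := eP _ Dx.
move=> D' sD' cov.
set s : seq 'rV[R]_m := finmap.enum_fset D'.
have sP t : t \in s -> slice C t by move=> /sD'; rewrite inE.
pose W x := \sum_(t <- s) bump (e t) t x ^+ 2.
have [c c0 cs] : exists2 c, 0 < c & forall t, t \in s -> c <= (e t / 2) ^+ 2.
  apply: pos_lower_bound => t /sP/eP[e0 _].
  by rewrite exprn_gt0 // divr_gt0.
have Wc x : slice C x -> c <= W x.
  move=> /cov[t /= ts xt]; rewrite /W (big_rem t) //=.
  apply: ler_wpDr; first by apply: sumr_ge0 => i _; apply: sqr_ge0.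
  apply: le_trans (cs t ts) _.
  have [e0 _] := eP _ (sP _ ts).
  rewrite ler_sqr ?nnegrE ?bump_ge0 ?divr_ge0 ?(ltW e0) //.
  by rewrite /bump le_max; apply/orP; right; move: xt => /=; lra.
have sW : root_lip (slice C) W.
  apply: root_lip_sum => t /sP/eP[e0 _].
  by apply: root_lip_sqr; apply: bdd_lip_bump; apply: ltW.
have := @conicZ _ _ (cone C) (slice C) (fun x => \sum_(t <- s) bump (e t) t x ^+ 2 *: x)
  _ (root_lipV c0 Wc sW).
move=> /(_ _)/conic_eq; apply.
  move=> x Dx; rewrite -scaler_suml scalerA mulVf ?scale1r //.
  by rewrite gt_eqF // (lt_le_trans c0) // Wc.
apply: conic_sum => t /sP/eP[e0 ce].
by apply: (conic_bump (ltW e0)).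
Qed.

(** Both points are scaled by squares, so their roots scale by [a] and [b].
    The change of [a * f] splits into a radial part, controlled by [|a - b|], and
    an angular part, in which [b * root_dist p p'] exceeds the distance of the
    scaled points by at most [|a - b|] in each coordinate. *)
Lemma homogeneous_dist (p p' : 'rV[R]_m) (a b f f' N : R) :
  0 <= a -> 0 <= b -> (forall i, 0 <= p 0 i <= 1) -> (forall i, 0 <= p' 0 i) ->
  `|f| <= N -> `|f - f'| <= N * root_dist p p' ->
  `|a - b| <= root_dist (a ^+ 2 *: p) (b ^+ 2 *: p') ->
  `|a * f - b * f'| <= (N * (2 + m%:R)) * root_dist (a ^+ 2 *: p) (b ^+ 2 *: p').
Proof.
move=> a0 b0 p0 p0' fN ffN; set rr := root_dist _ _ => ab.
have N0 : 0 <= N by apply: le_trans fN.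
have -> : a * f - b * f' = (a - b) * f + b * (f - f') by ring.
apply: le_trans (ler_normD _ _) _; rewrite !normrM (ger0_norm b0).
have h1 : `|a - b| * `|f| <= rr * N by apply: ler_pM.
have h2 : b * root_dist p p' <= rr + m%:R * rr.
  rewrite /root_dist mulr_sumr.
  have -> : m%:R * rr = \sum_(i < m) rr by rewrite sumr_const card_ord mulr_natl.
  rewrite -big_split /=; apply: ler_sum => i _.
  rewrite -[leLHS](_ : `|b * (Num.sqrt (p 0 i) - Num.sqrt (p' 0 i))| = _); last first.
    by rewrite normrM (ger0_norm b0).
  rewrite !mxE (sqrtrM _ (sqr_ge0 a)) (sqrtrM _ (sqr_ge0 b)) !sqrtr_sqr.
  rewrite (ger0_norm a0) (ger0_norm b0).
  set sp := Num.sqrt _; set sp' := Num.sqrt _.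
  have -> : b * (sp - sp') = (a * sp - b * sp') - (a - b) * sp by ring.
  apply: le_trans (ler_normB _ _) _; rewrite lerD2l normrM -[leRHS]mulr1.
  have /andP[pi0 pi1] := p0 i.
  apply: ler_pM => //; rewrite ger0_norm ?sqrtr_ge0 // -sqrtr1 ler_sqrt //.
have h3 : b * `|f - f'| <= b * (N * root_dist p p') by apply: ler_wpM2l.
have h4 : N * (b * root_dist p p') <= N * (rr + m%:R * rr) by apply: ler_wpM2l.
nra.
Qed.

(** The degree one homogeneous extension of the coefficients on the slice. *)
Lemma conic_root_generated q (C : 'M[R]_(q, m)) :
  conic (cone C) (slice C) id -> root_generated C.
Proof.
move=> [J [r [k [rC sk kE]]]].
have /choice[n nP] (j : J) : exists n, 0 <= n /\ forall x y, slice C x -> slice C y ->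
    `|Num.sqrt (k j x)| <= n /\ `|Num.sqrt (k j x) - Num.sqrt (k j y)| <= n * root_dist x y.
  by have [_ [n n0 nk]] := sk j; exists n.
pose N := \sum_j n j.
have N0 : 0 <= N by apply: sumr_ge0 => j _; case: (nP j).
have nN j : n j <= N.
  by rewrite /N (bigD1 j) //= lerDl sumr_ge0 // => l _; case: (nP l).
pose sg (x : 'rV[R]_m) := \sum_i x 0 i.
pose K j x := if sg x == 0 then 0 else sg x * k j ((sg x)^-1 *: x).
have sg0 x : cone C x -> 0 <= sg x by move=> [_ x0]; apply: sumr_ge0.
have sg_eq0 x : cone C x -> sg x = 0 -> x = 0.
  move=> [_ x0] /eqP; rewrite psumr_eq0 // => /allP h.
  by apply/rowP => i; rewrite mxE; apply/eqP/h; rewrite mem_index_enum.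
have sgS x : cone C x -> sg x != 0 -> slice C ((sg x)^-1 *: x).
  move=> Cx sx; split; first by apply: coneZ => //; rewrite invr_ge0 sg0.
  rewrite /=; under eq_bigr do rewrite mxE.
  by rewrite -mulr_sumr mulVf.
have sgd x y : cone C x -> cone C y -> `|Num.sqrt (sg x) - Num.sqrt (sg y)| <= root_dist x y.
  by move=> [_ x0] [_ y0]; apply: dist_sqrt_sum.
have sg00 : sg 0 = 0 by rewrite /sg big1 // => i _; rewrite mxE.
have kb j x : cone C x -> sg x != 0 ->
   Num.sqrt (K j x) = Num.sqrt (sg x) * Num.sqrt (k j ((sg x)^-1 *: x)).
  by move=> Cx sx; rewrite /K (negbTE sx) sqrtrM ?sg0.
have KD0 j x : cone C x -> sg x != 0 -> `|Num.sqrt (K j x)| <= N * root_dist x 0.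
  move=> Cx sx; rewrite kb // normrM mulrC; apply: ler_pM => //.
    have [_ /(_ _ _ (sgS _ Cx sx) (sgS _ Cx sx))[h _]] := nP j.
    exact: le_trans h (nN j).
  by have := sgd _ _ Cx (cone0 C); rewrite sg00 sqrtr0 subr0.
exists J, r, K, (N * (2 + m%:R)); split=> //.
- move=> j x Cx; rewrite /K; case: ifP => // /negbT sx.
  rewrite mulr_ge0 ?sg0 //; have [h _] := sk j; apply: h; exact: sgS.
- by move=> j; rewrite /K sg00 eqxx.
- split; first by rewrite mulr_ge0 // addr_ge0.
  have NN x y : N * root_dist x y <= N * (2 + m%:R) * root_dist x y.
    rewrite ler_wpM2r ?root_dist_ge0 // ler_peMr //.
    by rewrite -[leLHS]addr0 lerD // ler1n.
  move=> j x y Cx Cy.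
  have [sx|sx] := eqVneq (sg x) 0; have [sy|sy] := eqVneq (sg y) 0.
  + by rewrite (sg_eq0 x) // (sg_eq0 y) // subrr normr0 root_distxx mulr0.
  + rewrite (sg_eq0 x) // [K j 0]/K sg00 eqxx sqrtr0 sub0r normrN root_distC.
    exact: le_trans (KD0 _ _ Cy sy) (NN _ _).
  + rewrite (sg_eq0 y) // [K j 0]/K sg00 eqxx sqrtr0 subr0.
    exact: le_trans (KD0 _ _ Cx sx) (NN _ _).
  set p := (sg x)^-1 *: x; set p' := (sg y)^-1 *: y.
  have xE : x = Num.sqrt (sg x) ^+ 2 *: p.
    by rewrite sqr_sqrtr ?sg0 // /p scalerA divff // scale1r.
  have yE : y = Num.sqrt (sg y) ^+ 2 *: p'.
    by rewrite sqr_sqrtr ?sg0 // /p' scalerA divff // scale1r.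
  have Dp := sgS _ Cx sx; have Dp' := sgS _ Cy sy.
  have [_ /(_ _ _ Dp Dp')[h1 h2]] := nP j.
  rewrite !kb // [in leRHS]xE [in leRHS]yE.
  apply: homogeneous_dist; rewrite ?sqrtr_ge0 //.
  + by move=> i; rewrite (slice_le1 i Dp) andbT; have [[_ ->]] := Dp.
  + by move=> i; have [[_ ->]] := Dp'.
  + exact: le_trans h1 (nN j).
  + by apply: le_trans h2 _; rewrite ler_wpM2r ?root_dist_ge0.
  + by rewrite -xE -yE; apply: sgd.
move=> x Cx; have [sx|sx] := eqVneq (sg x) 0.
  rewrite (sg_eq0 x Cx sx) big1 // => j _.
  by rewrite /K sg00 eqxx scale0r.
have := kE _ (sgS _ Cx sx) => /= xE.
rewrite -[LHS](scalerKV sx) xE scaler_sumr; apply: eq_bigr => j _.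
by rewrite scalerA /K (negbTE sx).
Qed.

(** Induction on the rank: masking at [x0] kills the vector [x0] of the row
    space, hence lowers the rank. *)
Theorem cone_root_generated q (C : 'M[R]_(q, m)) : root_generated C.
Proof.
have [n] := ubnP (\rank C); elim: n => // n IH in q C *; rewrite ltnS => rC.
apply/conic_root_generated/slice_conic => x0 Dx0; apply: local_conic => //.
apply: IH; apply: leq_trans rC.
have [[x0C x00] /= sx0] := Dx0.
rewrite -(mxrank_mul_ker C (zero_mask x0)) -[ltnLHS]addn0 ltn_add2l lt0n.
apply/eqP => /eqP; rewrite mxrank_eq0 => /eqP K0.
have : (x0 <= C :&: kermx (zero_mask x0))%MS.
  rewrite sub_capmx x0C; apply/sub_kermxP/rowP => i.
  by rewrite mul_zero_mask mxE; case: eqP.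
rewrite K0 submx0 => /eqP x0E; move: sx0; rewrite x0E big1 => [/eqP|i _].
  by rewrite eq_sym oner_eq0.
by rewrite mxE.
Qed.
End ConeTheorem.

(** * Euclidean inner product and norm *)

Section Euclidean.
Variables (R : realType) (d : nat).
Implicit Types c x y z : 'rV[R]_d.

Lemma dotvDr x y z : dotv x (y + z) = dotv x y + dotv x z.
Proof. by rewrite /dotv -big_split; apply: eq_bigr => i _; rewrite mxE mulrDr. Qed.

Lemma dotvZr x a y : dotv x (a *: y) = a * dotv x y.
Proof. by rewrite /dotv mulr_sumr; apply: eq_bigr => i _; rewrite mxE mulrCA. Qed.

Lemma dotvNr x y : dotv x (- y) = - dotv x y.
Proof. by rewrite -scaleN1r dotvZr mulN1r. Qed.

Lemma dotv0r x : dotv x 0 = 0.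
Proof. by rewrite -(scale0r 0) dotvZr mul0r. Qed.

Lemma dotv_sumr x (I : Type) (s : seq I) (F : I -> 'rV[R]_d) :
  dotv x (\sum_(i <- s) F i) = \sum_(i <- s) dotv x (F i).
Proof. exact: (big_morph _ (dotvDr x) (dotv0r x)). Qed.

Lemma dotv_continuous c : continuous (dotv c).
Proof.
apply: (@continuous_sum R 'rV[R]_d) => i x.
exact: (cvgM (cvg_cst _) (@coord_continuous _ _ _ 0 i x)).
Qed.

Lemma coord_le_norm x l : `|x 0 l| <= `|x|.
Proof.
rewrite -[`|x|]/(mx_norm x) mx_normrE.
exact: (le_bigmax _ (fun ij : 'I_1 * 'I_d => `|x ij.1 ij.2|) (0, l)).
Qed.

Lemma coord_le_enorm x l : `|x 0 l| <= enorm x.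
Proof.
rewrite -sqrtr_sqr /enorm ler_sqrt; last first.
  by apply: sumr_ge0 => i _; rewrite -expr2 sqr_ge0.
by rewrite /dotv (bigD1 l) //= -expr2 lerDl sumr_ge0 // => i _; rewrite -expr2 sqr_ge0.
Qed.

Lemma enorm_le_sum x : enorm x <= \sum_l `|x 0 l|.
Proof.
have := @dist_sqrt_sum R _ (index_enum 'I_d) (fun l => x 0 l ^+ 2) (fun=> 0)
  (fun _ => sqr_ge0 _) (fun _ => lexx _).
rewrite [X in _ - Num.sqrt X]big1 // sqrtr0 subr0 => /(le_trans (ler_norm _)) h.
apply: le_trans (le_trans h _).
  by rewrite /enorm /dotv; under eq_bigr do rewrite -expr2.
by apply: ler_sum => l _; rewrite subr0 sqrtr_sqr normr_id.
Qed.

Lemma enorm_ge0 x : 0 <= enorm x.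
Proof. exact: sqrtr_ge0. Qed.

Lemma enormZ a x : enorm (a *: x) = `|a| * enorm x.
Proof.
rewrite /enorm dotvZr; have -> : dotv (a *: x) x = a * dotv x x.
  by rewrite -dotvZr /dotv; apply: eq_bigr => i _; rewrite mulrC.
by rewrite mulrA -expr2 sqrtrM ?sqr_ge0 // sqrtr_sqr.
Qed.

Lemma enorm_eq0 x : enorm x = 0 -> x = 0.
Proof.
move=> v0; apply/rowP => i; rewrite mxE; apply/eqP; rewrite -normr_le0 -v0.
exact: coord_le_enorm.
Qed.

Lemma dotv_le c x : `|dotv c x| <= (\sum_l `|c 0 l|) * enorm x.
Proof.
rewrite /dotv mulr_suml; apply: le_trans (ler_norm_sum _ _ _) _.
by apply: ler_sum => l _; rewrite normrM ler_wpM2l // coord_le_enorm.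
Qed.

Lemma bounded_ray (P : set 'rV[R]_d) p w :
  bounded_set P -> (forall s, 0 <= s -> P (p + s *: w)) -> w = 0.
Proof.
move=> [M [_ PM]] Pw; apply/eqP; apply: contraT => w0.
have nw : 0 < `|w| by rewrite normr_gt0.
pose B := `|M| + 1.
have MB : M < B by rewrite /B (le_lt_trans (ler_norm M)) // ltrDl.
pose s := (B + `|p| + 1) / `|w|.
have s0 : 0 <= s by rewrite divr_ge0 // !addr_ge0.
have := PM B MB _ (Pw s s0) => /=.
have : `|s *: w| <= `|p + s *: w| + `|p|.
  by rewrite -{1}[s *: w](addKr p) addrC; apply: ler_normB.
rewrite normrZ (ger0_norm s0) /s divfK ?gt_eqF // => h1 h2.
have : B + `|p| + 1 <= B + `|p| by apply: le_trans h1 _; rewrite lerD2r.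
by rewrite gerDl ler10.
Qed.
End Euclidean.

(** * Polytopes, their vertices and barycentric coordinates *)

Definition in_hull (R : realType) (d n : nat) (a : 'I_n -> 'rV[R]_d) x :=
  exists w : 'I_n -> R,
    [/\ forall k, 0 <= w k, \sum_k w k = 1 & x = \sum_k w k *: a k].

Lemma in_hull_segment (R : realType) (d n : nat) (a : 'I_n -> 'rV[R]_d) y z t :
  0 <= t -> t <= 1 -> in_hull a y -> in_hull a z ->
  in_hull a (t *: y + (1 - t) *: z).
Proof.
move=> t0 t1 [v [v0 v1 ->]] [w [w0 w1 ->]].
exists (fun k => t * v k + (1 - t) * w k); split=> [k||].
- by rewrite addr_ge0 // mulr_ge0 // subr_ge0.
- by rewrite big_split /= -!mulr_sumr v1 w1; ring.
rewrite !scaler_sumr -big_split /=; apply: eq_bigr => k _.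
by rewrite !scalerA -scalerDl.
Qed.

Section Polytope.
Variables (R : realType) (d m : nat) (c : 'I_m -> 'rV[R]_d) (b : 'I_m -> R).
Implicit Types x y : 'rV[R]_d.

Definition halfspaces : set 'rV[R]_d := [set x | forall i, dotv (c i) x <= b i].

Definition inactive x : {set 'I_m} := [set i | dotv (c i) x != b i].

(** Follow a line along which the active constraints stay active until the first
    other constraint becomes active; boundedness makes this happen. *)
Lemma leave_along x w : bounded_set halfspaces -> halfspaces x -> w != 0 ->
  (forall i, dotv (c i) x = b i -> dotv (c i) w = 0) ->
  exists2 s, 0 < s & halfspaces (x + s *: w) /\
    (#|inactive (x + s *: w)| < #|inactive x|)%N.
Proof.
move=> bP Px w0 act.
have [i0 wi0] : exists i, 0 < dotv (c i) w.
  apply: contrapT => no; move/negP: w0; apply; apply/eqP.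
  apply: (bounded_ray (p := x) bP) => s s0 i.
  rewrite dotvDr dotvZr -[leRHS]addr0; apply: lerD; first exact: Px.
  rewrite mulr_ge0_le0 // leNgt; apply/negP => wi; apply: no; by exists i.
(* The time at which the line meets the [i]-th bounding hyperplane. *)
pose ratio i := (b i - dotv (c i) x) / dotv (c i) w.
case: (@arg_minP _ _ _ i0 (fun i => 0 < dotv (c i) w) ratio wi0) => i wi imin.
have xi : dotv (c i) x < b i.
  rewrite lt_neqAle Px andbT; apply/negP => /eqP/act wi'.
  by rewrite wi' ltxx in wi.
have s0 : 0 < ratio i by rewrite divr_gt0 // subr_gt0.
exists (ratio i) => //; split.
  move=> j; rewrite dotvDr dotvZr -lerBrDl.
  have [wj|wj] := ltP 0 (dotv (c j) w).
    by rewrite -ler_pdivlMr // imin.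
  by rewrite (@le_trans _ _ 0) ?subr_ge0 ?Px // mulr_ge0_le0 // ltW.
apply: proper_card; apply/properP; split.
  apply/fintype.subsetP => j; rewrite !inE; apply: contra => /eqP xj.
  by rewrite dotvDr dotvZr (act j xj) mulr0 addr0 xj.
exists i; first by rewrite inE lt_eqF.
by rewrite inE dotvDr dotvZr /ratio (divfK (lt0r_neq0 wi)) addrC subrK eqxx.
Qed.

(** A point that is not a vertex lies inside a segment, on which every constraint
    active at the point is constant.  Prolonging the segment both ways to the
    boundary yields two points with fewer inactive constraints whose segment
    contains the given point. *)
Theorem hull_of_vertices n (a : 'I_n -> 'rV[R]_d) x :
  bounded_set halfspaces -> range a = vertices halfspaces ->
  halfspaces x -> in_hull a x.
Proof.
move=> bP av; have [k] := ubnP #|inactive x|.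
elim: k => // k IH in x *; rewrite ltnS => xk Px.
have [vx|nvx] := pselect (vertices halfspaces x).
  move: vx; rewrite -av => -[l _ <-].
  exists (fun j => (j == l)%:R); split=> [j||].
  - exact: ler0n.
  - by rewrite (bigD1 l) //= eqxx big1 ?addr0 // => j /negbTE->.
  by rewrite (bigD1 l) //= eqxx scale1r big1 ?addr0 // => j /negbTE->; rewrite scale0r.
have [y [z [t [Py Pz /andP[t0 t1] xE yz]]]] : exists y z t,
    [/\ halfspaces y, halfspaces z, 0 < t < 1, x = t *: y + (1 - t) *: z & y <> z].
  apply: contrapT => no; apply: nvx; split=> // y z t Py Pz t01 xE.
  by apply: contrapT => yz; apply: no; exists y, z, t.
have w0 : y - z != 0 by rewrite subr_eq0; apply/eqP.
have t1' : 0 < 1 - t by rewrite subr_gt0.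
have act i : dotv (c i) x = b i -> dotv (c i) (y - z) = 0.
  rewrite xE !dotvDr !dotvZr dotvNr => xi.
  by have := Py i; have := Pz i; nra.
have [s s0 [Ps sk]] := leave_along bP Px w0 act.
have [||s' s0' [Ps' sk']] := leave_along (w := - (y - z)) bP Px.
  by rewrite oppr_eq0.
  by move=> i /act; rewrite dotvNr => ->; rewrite oppr0.
have -> : x = (s' / (s + s')) *: (x + s *: (y - z)) +
    (1 - s' / (s + s')) *: (x + s' *: - (y - z)).
  have ss : s + s' != 0 by rewrite gt_eqF // addr_gt0.
  by apply/rowP => i; rewrite !mxE; field.
apply: in_hull_segment.
- by rewrite divr_ge0 ?ltW // addr_gt0.
- by rewrite ler_pdivrMr ?addr_gt0 // mul1r lerDr ltW.
- by apply: IH => //; apply: leq_trans xk.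
- by apply: IH => //; apply: leq_trans xk.
Qed.

(** The additional coordinate 1 homogenises: the polytope becomes a section of the
    cone of [slack_mx], which maps [(t, x)] to
    [(t, t * b_i - dotv (c_i) x)]. *)
Definition slack x : 'rV[R]_(1 + m) :=
  row_mx 1%:M (\row_i (b i - dotv (c i) x)).

Definition slack_mx : 'M[R]_(1 + d, 1 + m) :=
  block_mx 1%:M (\row_i b i) 0 (\matrix_(l, i) - c i 0 l).

Lemma mul_slack_mxl t x : (row_mx t x *m slack_mx) 0 (lshift m 0) = t 0 0.
Proof. by rewrite /slack_mx mul_row_block row_mxEl mulmx0 addr0 mulmx1. Qed.

Lemma mul_slack_mxr t x i :
  (row_mx t x *m slack_mx) 0 (rshift 1 i) = t 0 0 * b i - dotv (c i) x.
Proof.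
rewrite /slack_mx mul_row_block row_mxEr.
rewrite !mxE big_ord1 !mxE; congr (_ + _); rewrite /dotv -sumrN.
by apply: eq_bigr => l _; rewrite !mxE mulrN mulrC.
Qed.

Lemma slackE x : slack x = row_mx 1%:M x *m slack_mx.
Proof.
apply/rowP => i; case: (split_ordP i) => j ->.
  by rewrite [j]ord1 /slack row_mxEl mul_slack_mxl.
by rewrite mul_slack_mxr /slack row_mxEr !mxE eqxx mul1r.
Qed.

Lemma slack_cone x : halfspaces x -> cone slack_mx (slack x).
Proof.
move=> Px; split; first by rewrite slackE submxMl.
move=> i; case: (split_ordP i) => j ->; rewrite /slack ?row_mxEl ?row_mxEr !mxE.
  by rewrite [j]ord1 eqxx ler01.
by rewrite subr_ge0.
Qed.

Lemma root_dist_slack x y : root_dist (slack x) (slack y) =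
  \sum_i `|Num.sqrt (b i - dotv (c i) x) - Num.sqrt (b i - dotv (c i) y)|.
Proof.
rewrite /root_dist big_split_ord /= big_ord1 /slack !row_mxEl subrr normr0 add0r.
by apply: eq_bigr => i _; rewrite !row_mxEr !mxE.
Qed.

Lemma cone_slackP r : cone slack_mx r ->
  exists (t : R) x, [/\ 0 <= t, r 0 (lshift m 0) = t
    & forall i, r 0 (rshift 1 i) = t * b i - dotv (c i) x /\ dotv (c i) x <= t * b i].
Proof.
move=> [/submxP[D ->] r0]; move: r0.
rewrite -[D]hsubmxK; set t := lsubmx D; set x := rsubmx D => r0.
exists (t 0 0), x; split.
- by have := r0 (lshift m 0); rewrite mul_slack_mxl.
- by rewrite mul_slack_mxl.
move=> i; split; first exact: mul_slack_mxr.
by have := r0 (rshift 1 i); rewrite mul_slack_mxr subr_ge0.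
Qed.

(** A generator of the cone with [t > 0] is [t] times the slack vector of a point
    of the polytope; one with [t = 0] is a recession direction, hence zero.
    The constant [N] does not depend on the enumeration of the vertices, because
    all convex weights are at most 1. *)
Theorem root_barycentric : bounded_set halfspaces ->
  exists2 N, 0 <= N & forall n (a : 'I_n -> 'rV[R]_d),
    range a = vertices halfspaces ->
    exists l : 'I_n -> 'rV[R]_d -> R,
      [/\ forall k x, halfspaces x -> 0 <= l k x,
          forall x, halfspaces x -> \sum_k l k x = 1,
          forall x, halfspaces x -> x = \sum_k l k x *: a k
        & forall k x y, halfspaces x -> halfspaces y ->
            `|Num.sqrt (l k x) - Num.sqrt (l k y)| <= N * root_dist (slack x) (slack y)].
Proof.
move=> bP.
have [[p Pp]|noP] := pselect (exists p, halfspaces p); last first.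
  by exists 0 => // n a _; exists (fun _ _ => 0); split=> // [x Px|x Px|k x y Px _];
    case: noP; exists x.
have [J [r [k [N [rC k0 k00 [N0 kN] kE]]]]] := cone_root_generated slack_mx.
pose t j := r j 0 (lshift m 0).
have t0 j : 0 <= t j := proj2 (rC j) _.
exists (\sum_j Num.sqrt (t j) * N).
  by apply: sumr_ge0 => j _; rewrite mulr_ge0 ?sqrtr_ge0.
move=> n a av.
(* [(z j).1] is the vector of the generator [r j], and [(z j).2] its convex
   weights on the vertices; the equations are multiplied by [t j] to cover the
   case [t j = 0]. *)
have /choice[z zP] (j : J) : exists z : 'rV[R]_d * ('I_n -> R),
   [/\ forall i, r j 0 (rshift 1 i) = t j * b i - dotv (c i) z.1,
       forall l, 0 <= z.2 l <= 1,
       t j * \sum_l z.2 l = t j & z.1 = \sum_l (t j * z.2 l) *: a l].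
  have [_ [x [_ <- xP]]] := cone_slackP (rC j); rewrite -/(t j) in xP.
  have [tz|tz] := eqVneq (t j) 0.
    have x0 : x = 0.
      apply: (bounded_ray (p := p) bP) => s s0 i; rewrite dotvDr dotvZr.
      rewrite -[leRHS]addr0; apply: lerD; first exact: Pp.
      by rewrite mulr_ge0_le0 //; have [_] := xP i; rewrite tz mul0r.
    exists (x, fun=> 0); split=> [i|l||] /=.
    - by have [->] := xP i.
    - by rewrite lexx ler01.
    - by rewrite tz mul0r.
    by rewrite x0 big1 // => l _; rewrite mulr0 scale0r.
  have tp : 0 < t j by rewrite lt_neqAle eq_sym tz t0.
  have [|w [w0 w1 wE]] := @hull_of_vertices n a ((t j)^-1 *: x) bP av.
    by move=> i; rewrite dotvZr ler_pdivrMl //; have [] := xP i.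
  exists (x, w); split=> [i|l||] /=.
  - by have [->] := xP i.
  - by rewrite w0 -w1 (bigD1 l) //= lerDl sumr_ge0.
  - by rewrite w1 mulr1.
  under eq_bigr do rewrite -scalerA.
  by rewrite -scaler_sumr -wE scalerA divff // scale1r.
pose l i x := \sum_j (t j * (z j).2 i) * k j (slack x).
have tz0 j i : 0 <= t j * (z j).2 i.
  by rewrite mulr_ge0 //; have [_ /(_ i)/andP[]] := zP j.
exists l; split.
- by move=> i x Px; apply: sumr_ge0 => j _; rewrite mulr_ge0 // k0 //; apply: slack_cone.
- move=> x Px; rewrite /l exchange_big /=.
  have /rowP/(_ (lshift m 0)) := kE _ (slack_cone Px).
  rewrite {1}/slack row_mxEl !mxE eqxx summxE => E.
  transitivity (\sum_j (k j (slack x) *: r j) 0 (lshift m 0)); last exact: esym E.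
  apply: eq_bigr => j _; rewrite mxE -mulr_suml -mulr_sumr mulrC.
  by have [_ _ -> _] := zP j.
- move=> x Px.
  have -> : \sum_i l i x *: a i = \sum_j k j (slack x) *: (z j).1.
    rewrite /l; under eq_bigr do rewrite scaler_suml.
    rewrite exchange_big /=; apply: eq_bigr => j _.
    have [_ _ _ ->] := zP j; rewrite scaler_sumr; apply: eq_bigr => i _.
    by rewrite scalerA mulrC.
  apply/eqP; rewrite -subr_eq0; apply/eqP.
  (* Both points have the same slacks, so their difference spans a line inside
     the polytope. *)
  apply: (bounded_ray (p := x) bP) => s _ i; rewrite dotvDr dotvZr.
  suff -> : dotv (c i) (x - \sum_j k j (slack x) *: (z j).1) = 0.
    by rewrite mulr0 addr0; apply: Px.
  have /rowP slE := kE _ (slack_cone Px).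
  have := slE (rshift 1 i); rewrite {1}/slack row_mxEr !mxE summxE.
  have := slE (lshift m 0); rewrite {1}/slack row_mxEl !mxE summxE eqxx.
  under eq_bigr do rewrite mxE; move=> E1.
  have zE j : r j 0 (rshift 1 i) = t j * b i - dotv (c i) (z j).1.
    by have [] := zP j.
  under eq_bigr do rewrite mxE zE.
  move=> E2; rewrite dotvDr dotvNr dotv_sumr.
  under eq_bigr do rewrite dotvZr.
  move: E2; under eq_bigr do rewrite mulrBr mulrA.
  rewrite big_split /= sumrN -mulr_suml -E1 mul1r; lra.
move=> i x y Px Py.
have Cx := slack_cone Px; have Cy := slack_cone Py.
apply: le_trans (dist_sqrt_sum _ _ _) _.
- by move=> j; rewrite mulr_ge0 ?k0.
- by move=> j; rewrite mulr_ge0 ?k0.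
rewrite mulr_suml; apply: ler_sum => j _.
rewrite !(sqrtrM _ (tz0 j i)) -mulrBr normrM (ger0_norm (sqrtr_ge0 _)) -mulrA.
apply: ler_pM => //; rewrite ?sqrtr_ge0 //; last exact: kN.
rewrite ler_sqrt // ler_piMr //.
by have [_ /(_ i)/andP[]] := zP j.
Qed.
End Polytope.

(** * Derivatives along a line *)

Section Directional.
Variables (R : realType) (m : nat).
Local Notation V := 'rV[R]_m.
Implicit Types (x y z v e : V).

Lemma is_deriveP (W W' : normedModType R) (f : W -> W') (a v : W) L :
  is_derive a v f L <->
  h^-1 *: (f (h *: v + a) - f a) @[h --> (0 : R)^'] --> L.
Proof.
split=> [[fd <-]|fL]; first exact: fd.
apply: DeriveDef; first by apply/cvg_ex; exists L.
by apply: cvg_lim => //; apply: norm_hausdorff.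
Qed.

Lemma line_derive (f : V -> R) t w y L :
  is_derive (t *: w + y) w f L -> is_derive t 1 (fun s : R => f (s *: w + y)) L.
Proof.
move=> /is_deriveP fL; apply/is_deriveP; apply: cvg_trans fL.
apply: near_eq_cvg; near=> h.
congr (_ *: (f _ - f _)).
by rewrite scalerDl scaler1 addrA.
Unshelve. all: by end_near. Qed.

Lemma mvt_from0 (f df : R -> R) (b : R) :
  (forall t : R, is_derive t 1 f (df t)) ->
  exists2 c, `|c| <= `|b| & f b - f 0 = df c * b.
Proof.
move=> fd; have cf : continuous f.
  move=> t; apply: differentiable_continuous; apply/derivable1_diffP.
  by case: (fd t).
have [b0|b0] := leP 0 b.
  have [c cb fE] := MVT_segment b0 (fun t _ => fd t) (continuous_subspaceT cf).
  exists c; last by rewrite fE subr0.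
  by move: cb; rewrite in_itv /= => /andP[c0 cb]; rewrite !ger0_norm.
have [c cb fE] := MVT_segment (ltW b0) (fun t _ => fd t) (continuous_subspaceT cf).
exists c; last by rewrite -opprB fE sub0r mulrN opprK.
move: cb; rewrite in_itv /= => /andP[bc c0].
by rewrite ler0_norm // ltr0_norm // lerN2.
Qed.

(** Differentiability in one direction at [z], together with a continuous
    derivative in another, gives differentiability in the sum of the directions:
    the mean value theorem evaluates the latter at points that tend to [z]. *)
Lemma is_derive_addl (f De : V -> R) z v e a L :
  (forall x, is_derive x e f (De x)) -> continuous De ->
  is_derive z v f L -> is_derive z (v + a *: e) f (L + a * De z).
Proof.
move=> fe cDe /is_deriveP fv; apply/is_deriveP.
(* The intermediate point of the mean value theorem, as a function of the
   increment. *)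
have /choice[c cP] (h : R) : exists c : R, `|c| <= `|h * a| /\
    f ((h * a) *: e + (h *: v + z)) - f (h *: v + z) =
    De (c *: e + (h *: v + z)) * (h * a).
  have [|c cb cE] := @mvt_from0 (fun s => f (s *: e + (h *: v + z)))
    (fun s => De (s *: e + (h *: v + z))) (h * a).
    by move=> t; apply: line_derive.
  by exists c; split=> //; rewrite -cE scale0r add0r.
have c0 : c h @[h --> (0 : R)^'] --> (0 : R).
  apply/cvgr0Pnorm_lt => eps eps0.
  have a0 : 0 < `|a| + 1 by rewrite ltr_pwDr.
  near=> h; have [ch _] := cP h; apply: le_lt_trans ch _; rewrite normrM.
  have hs : `|h| < eps / (`|a| + 1) by near: h; apply: dnbhs0_lt; rewrite divr_gt0.
  apply: (@le_lt_trans _ _ (`|h| * (`|a| + 1))); last by rewrite -ltr_pdivlMr.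
  by rewrite ler_wpM2l // lerDl.
have h0 : h @[h --> (0 : R)^'] --> (0 : R) by apply: nbhs_dnbhs.
have lim : c h *: e + (h *: v + z) @[h --> (0 : R)^'] --> z.
  have : c h *: e + (h *: v + z) @[h --> (0 : R)^'] --> 0 *: e + (0 *: v + z).
    apply: cvgD; first exact: (cvgZ c0 (cvg_cst e)).
    by apply: cvgD; [exact: (cvgZ h0 (cvg_cst v))|exact: cvg_cst].
  by rewrite !scale0r !add0r.
have Dlim : De (c h *: e + (h *: v + z)) @[h --> (0 : R)^'] --> De z.
  exact: (cvg_comp _ _ lim (cDe z)).
have tot : h^-1 *: (f (h *: v + z) - f z) + a * De (c h *: e + (h *: v + z))
    @[h --> (0 : R)^'] --> L + a * De z.
  exact: (cvgD fv (cvgM (cvg_cst a) Dlim)).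
apply: cvg_trans tot; apply: near_eq_cvg; near=> h.
have hn : h != 0 by near: h; exact: nbhs_dnbhs_neq.
have [_ E] := cP h => /=.
have -> : h *: (v + a *: e) + z = (h * a) *: e + (h *: v + z).
  by rewrite scalerDr scalerA addrA [(h * a) *: e + _]addrC.
have -> : f ((h * a) *: e + (h *: v + z)) =
   f (h *: v + z) + De (c h *: e + (h *: v + z)) * (h * a).
  by rewrite -E [RHS]addrC subrK.
rewrite /GRing.scale /=; field.
exact: hn.
Unshelve. all: by end_near. Qed.

Lemma is_derive_partials (f : V -> R) (D : 'I_m -> V -> R) w z :
  (forall i x, is_derive x (delta_mx 0 i) f (D i x)) ->
  (forall i, continuous (D i)) ->
  is_derive z w f (\sum_i w 0 i * D i z).
Proof.
move=> fD cD; rewrite {1}[w]row_sum_delta.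
elim: (index_enum _) => [|i s IH].
  rewrite !big_nil; apply/is_deriveP.
  have c0 : (0 : R) @[_ --> (0 : R)^'] --> (0 : R) by exact: cvg_cst.
  apply: cvg_trans c0.
  apply: near_eq_cvg; near=> h => /=.
  by rewrite scaler0 add0r subrr scaler0.
by rewrite !big_cons addrC [X in is_derive _ _ _ X]addrC; apply: is_derive_addl.
Unshelve. all: by end_near. Qed.

(** Two applications of the mean value theorem give
    [p h <= p 0 + h * p1 0 + M * h^2] for all [h].  The right side is nonnegative
    at its minimiser, so [p1 0 ^ 2 <= 4 * M * p 0], and at [h = 1] it is at most
    [(sqrt (p 0) + sqrt M)^2]. *)
Lemma sqrt_C2_step (p p1 p2 : R -> R) (M : R) : 0 < M ->
  (forall t, 0 <= p t) ->
  (forall t : R, is_derive t 1 p (p1 t)) ->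
  (forall t : R, is_derive t 1 p1 (p2 t)) ->
  (forall t, `|p2 t| <= M) ->
  Num.sqrt (p 1) <= Num.sqrt (p 0) + Num.sqrt M.
Proof.
move=> M0 p0 dp dp1 p2M.
have taylor h : p h <= p 0 + h * p1 0 + M * h ^+ 2.
  have [c ch E] := mvt_from0 h dp; have [c' _ E'] := mvt_from0 c dp1.
  have : `|(p1 c - p1 0) * h| <= M * h ^+ 2.
    rewrite -(real_normK (num_real h)) expr2 E' !normrM -mulrA.
    by apply: ler_pM => //; apply: ler_pM.
  by rewrite ler_norml => /andP[_]; lra.
(* The step is the minimiser of the quadratic bound. *)
have disc : p1 0 ^+ 2 <= 4 * M * p 0.
  have := le_trans (p0 _) (taylor (- p1 0 / (2 * M))).
  have -> : p 0 + - p1 0 / (2 * M) * p1 0 + M * (- p1 0 / (2 * M)) ^+ 2 =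
     p 0 - p1 0 ^+ 2 / (4 * M) by field; rewrite gt_eqF.
  rewrite subr_ge0 ler_pdivrMr ?mulr_gt0 // => h; apply: le_trans h _.
  by rewrite le_eqVlt; apply/orP; left; apply/eqP; ring.
set s := Num.sqrt (p 0); set r := Num.sqrt M.
have s0 : 0 <= s by apply: sqrtr_ge0. have r0 : 0 <= r by apply: sqrtr_ge0.
have sE : s ^+ 2 = p 0 by apply: sqr_sqrtr.
have rE : r ^+ 2 = M by apply: sqr_sqrtr; apply: ltW.
have p1s : p1 0 <= 2 * r * s.
  apply: le_trans (ler_norm _) _.
  rewrite -ler_sqr ?nnegrE ?mulr_ge0 // real_normK ?num_real //.
  by rewrite !exprMn sE rE; move: disc; lra.
have t1 := taylor 1.
rewrite -(ger0_norm (addr_ge0 s0 r0)) -sqrtr_sqr ler_sqrt ?sqr_ge0 //.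
rewrite sqrrD sE rE; move: t1 p1s; rewrite expr1n; lra.
Qed.
End Directional.

(** * Slacks along a map with bounded second derivatives *)

Section DerivativeBounds.
Variables (R : realType) (m d : nat) (u : 'rV[R]_m -> 'rV[R]_d).
Hypothesis hu : C2_bounded_derivs u.

Lemma is_derive_dotv (w : 'rV[R]_m -> 'rV[R]_d) (c : 'rV[R]_d) x e :
  derivable w x e -> is_derive x e (fun y => dotv c (w y)) (dotv c ('D_e w x)).
Proof.
move=> wd; apply/is_deriveP.
have := cvg_comp _ _ wd (@dotv_continuous R d c _); apply: cvg_trans.
apply: near_eq_cvg; near=> h.
by rewrite /= dotvZr dotvDr dotvNr.
Unshelve. all: by end_near. Qed.

Lemma second_derivative_line c (w y : 'rV[R]_m) (t : R) :
  is_derive t 1 (fun s : R => \sum_i w 0 i * dotv c (pderiv i u (s *: w + y)))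
    (dotv c (dderiv2 u w (t *: w + y))).
Proof.
have [h1 h2] := hu.
apply: (line_derive (f := fun z => \sum_i w 0 i * dotv c (pderiv i u z))).
have -> : dotv c (dderiv2 u w (t *: w + y)) = \sum_j w 0 j *
    \sum_i w 0 i * dotv c (pderiv j (pderiv i u) (t *: w + y)).
  rewrite /dderiv2 dotv_sumr; under eq_bigr do rewrite dotv_sumr.
  rewrite exchange_big /=; apply: eq_bigr => j _.
  rewrite mulr_sumr; apply: eq_bigr => i _.
  by rewrite dotvZr mulrA [w 0 i * _]mulrC.
apply: (is_derive_partials (D := fun j z =>
   \sum_i w 0 i * dotv c (pderiv j (pderiv i u) z))) => [j x|j].
  have -> : (fun z => \sum_i w 0 i * dotv c (pderiv i u z)) =
      \sum_i (w 0 i \*: (fun z => dotv c (pderiv i u z)) : 'rV[R]_m -> R).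
    by apply/funext => z; rewrite fct_sumE.
  apply: is_derive_sum => i.
  have [dd _ _] := h2 i j.
  exact: (is_deriveZ (w 0 i) (is_derive_dotv c (dd x))).
apply: continuous_sum => i x; have [_ cd _] := h2 i j.
have cx : dotv c (pderiv j (pderiv i u) z) @[z --> x] -->
    dotv c (pderiv j (pderiv i u) x).
  exact: (cvg_comp _ _ (cd x) (@dotv_continuous R d c _)).
exact: (cvgM (cvg_cst _) cx).
Qed.

Lemma first_derivative_line c (w y : 'rV[R]_m) (t : R) :
  is_derive t 1 (fun s : R => dotv c (u (s *: w + y)))
    (\sum_i w 0 i * dotv c (pderiv i u (t *: w + y))).
Proof.
have [h1 _] := hu.
apply: (line_derive (f := fun z => dotv c (u z))).
apply: (is_derive_partials (D := fun i z => dotv c (pderiv i u z))) => [i x|i x].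
  by have [du _ _] := h1 i; apply: is_derive_dotv.
have [_ cu _] := h1 i.
exact: (cvg_comp _ _ (cu x) (@dotv_continuous R d c _)).
Qed.

(** The boundedness of the second partial derivatives is what makes the
    supremum an upper bound. *)
Lemma dderiv2_le_sup eta z : enorm eta = 1 -> enorm (dderiv2 u eta z) <= sup_dderiv2 u.
Proof.
move=> e1; apply: ub_le_sup; last by exists eta, z.
have [_ h2] := hu.
have /choice[B BP] (ij : 'I_m * 'I_m) : exists B, forall x,
    `|pderiv ij.2 (pderiv ij.1 u) x| <= B.
  have [_ _ [M [_ MB]]] := h2 ij.1 ij.2.
  by exists (M + 1) => x; apply: (MB (M + 1)) => //; rewrite ltrDl.
exists (\sum_(l < d) \sum_i \sum_j B (i, j)) => _ [xi [x [xi1 ->]]].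
apply: le_trans (enorm_le_sum _) _; apply: ler_sum => l _.
rewrite /dderiv2 summxE; apply: le_trans (ler_norm_sum _ _ _) _.
apply: ler_sum => i _; rewrite summxE; apply: le_trans (ler_norm_sum _ _ _) _.
apply: ler_sum => j _; rewrite mxE normrM -[leRHS]mul1r.
apply: ler_pM => //.
  rewrite normrM -[leRHS]mul1r -{1}xi1 -xi1; apply: ler_pM => //; exact: coord_le_enorm.
apply: le_trans (coord_le_norm _ _) _; exact: (BP (i, j)).
Qed.

Lemma dderiv2Z a eta z : dderiv2 u (a *: eta) z = a ^+ 2 *: dderiv2 u eta z.
Proof.
rewrite /dderiv2 scaler_sumr; apply: eq_bigr => i _.
rewrite scaler_sumr; apply: eq_bigr => j _.
by rewrite scalerA !mxE; congr (_ *: _); ring.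
Qed.

Lemma dderiv2_bound w z : enorm (dderiv2 u w z) <= sup_dderiv2 u * enorm w ^+ 2.
Proof.
have [w0|w0] := eqVneq (enorm w) 0.
  have -> : w = 0 *: w by rewrite (enorm_eq0 w0) scaler0.
  by rewrite dderiv2Z !enormZ normrX normr0 expr0n /= !mul0r expr0n mulr0.
have {1}-> : w = enorm w *: ((enorm w)^-1 *: w) by rewrite scalerA divff // scale1r.
rewrite dderiv2Z enormZ ger0_norm ?sqr_ge0 // mulrC ler_wpM2r ?sqr_ge0 //.
by apply: dderiv2_le_sup; rewrite enormZ ger0_norm ?invr_ge0 ?enorm_ge0 // mulVf.
Qed.

(** Lipschitz constant of the root of a slack with normal vector [c] when second
    directional derivatives are at most [K]; the summand 1 keeps the radicand
    positive. *)
Definition root_rate (c : 'rV[R]_d) (K : R) : R :=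
  Num.sqrt ((\sum_l `|c 0 l|) * K + 1).

Lemma sqrt_slack_le c b y z : (forall x, dotv c (u x) <= b) ->
  Num.sqrt (b - dotv c (u z)) <=
    Num.sqrt (b - dotv c (u y)) + root_rate c (sup_dderiv2 u) * enorm (z - y).
Proof.
move=> cb; have [->|yz] := eqVneq z y.
  by rewrite lerDl mulr_ge0 ?sqrtr_ge0 ?enorm_ge0.
set w := z - y.
have w0 : 0 < enorm w.
  rewrite lt_neqAle enorm_ge0 andbT eq_sym; apply: contra yz => /eqP/enorm_eq0.
  by rewrite /w => /eqP; rewrite subr_eq0.
set K := sup_dderiv2 u; set S := \sum_l `|c 0 l|.
have S0 : 0 <= S by apply: sumr_ge0.
have K0 : 0 <= K.
  have := le_trans (enorm_ge0 _) (dderiv2_bound w 0).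
  by rewrite pmulr_lge0 // exprn_gt0.
have SK : 0 < S * K + 1 by rewrite ltr_wpDl // mulr_ge0.
pose p (t : R) := b - dotv c (u (t *: w + y)).
have p0 : p 0 = b - dotv c (u y) by rewrite /p scale0r add0r.
have p1 : p 1 = b - dotv c (u z) by rewrite /p scale1r subrK.
have -> : root_rate c K * enorm w = Num.sqrt ((S * K + 1) * enorm w ^+ 2).
  by rewrite sqrtrM ?ltW // sqrtr_sqr ger0_norm // ltW.
rewrite -p0 -p1.
apply: (sqrt_C2_step (p1 := fun t => - \sum_i w 0 i * dotv c (pderiv i u (t *: w + y)))
  (p2 := fun t => - dotv c (dderiv2 u w (t *: w + y)))).
- by rewrite mulr_gt0 // exprn_gt0.
- by move=> t; rewrite subr_ge0.
- move=> t.
  have := is_deriveB (is_derive_cst b t (1 : R)) (first_derivative_line c w y t).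
  by rewrite sub0r.
- by move=> t; apply: is_deriveN; apply: second_derivative_line.
move=> t; rewrite normrN; apply: le_trans (dotv_le _ _) _.
apply: le_trans (ler_wpM2l S0 (dderiv2_bound _ _)) _.
by rewrite mulrA ler_wpM2r ?sqr_ge0 // lerDl.
Qed.

Lemma sqrt_slack_lip c b y z : (forall x, dotv c (u x) <= b) ->
  `|Num.sqrt (b - dotv c (u y)) - Num.sqrt (b - dotv c (u z))| <=
    root_rate c (sup_dderiv2 u) * enorm (y - z).
Proof.
move=> cb; have h1 := sqrt_slack_le y z cb; have h2 := sqrt_slack_le z y cb.
have E : enorm (z - y) = enorm (y - z).
  by rewrite -opprB -scaleN1r enormZ normrN1 mul1r.
by rewrite ler_norml; apply/andP; split; move: h1 h2; rewrite E; lra.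
Qed.
End DerivativeBounds.

(** * Barycentric coordinates of a polytope-valued map *)

Theorem theorem2p1 (R : realType) (d : nat) (P : set 'rV[R]_d)
    (hP : polyhedron P) (bP : bounded_set P) :
  exists N : R -> R,
    forall (n : nat) (a : 'I_n -> 'rV[R]_d),
      (2 <= n)%N -> injective a -> range a = vertices P ->
    forall (d1 : nat) (u : 'rV[R]_d1 -> 'rV[R]_d),
      (1 <= d1)%N -> (forall y, P (u y)) -> C2_bounded_derivs u ->
    exists v : 'I_n -> 'rV[R]_d1 -> R,
      [/\ forall k y, 0 <= v k y,
          forall y, \sum_(k < n) v k y = 1,
          forall y, u y = \sum_(k < n) v k y *: a k
        & forall k y z,
            `|Num.sqrt (v k y) - Num.sqrt (v k z)|
              <= N (sup_dderiv2 u) * enorm (y - z)].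
Proof.
have [m [c [b PE]]] := hP; subst P.
have [N N0 bary] := root_barycentric bP.
exists (fun K => N * \sum_i root_rate (c i) K).
move=> n a _ _ /bary[l [l0 l1 lE lN]] d1 u _ uP u2.
exists (fun k y => l k (u y)); split=> [k y|y|y|k y z].
- exact/l0/uP.
- exact/l1/uP.
- exact/lE/uP.
apply: le_trans (lN _ _ _ (uP y) (uP z)) _.
rewrite -mulrA ler_wpM2l // root_dist_slack mulr_suml; apply: ler_sum => i _.
by apply: sqrt_slack_lip => // x; apply: uP.
Qed.
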